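(* Let $f:\mathbb{R}^n\to\mathbb{R}$ and $c:\mathbb{R}^n\to\mathbb{R}^m$ and the trust-region funnel SQP algorithm described in the context satisfy the standard assumptions given there. Then the algorithm applied to $\min_{x} f(x)$ subject to $c(x)=0$, $x\ge0$ has one of the following outcomes: 1. The restoration phase fails to find a point $x$ that is both acceptable to the funnel and for which $QP(x,\Delta)$ has a feasible direction for some $\Delta\ge\Delta^\circ$. In this case the restoration phase converges to an infeasible limit point. 2. A KKT point of the problem is found ($d=0$ solves $QP(x^{(k)},\Delta)$ for some $k$). 3. There exists an accumulation point of the iterates that is feasible and either is a KKT point or fails to satisfy MFCQ.
   Context: The problem is $\min_{x\in\mathbb{R}^n} f(x)$ subject to $c(x)=0$, $x\ge0$. Write $f^{(k)}=f(x^{(k)})$, $h(x)=\|c(x)\|_1$, $h^{(k)}=h(x^{(k)})$; $\nabla c(x)^T\in\mathbb{R}^{m\times n}$ is the Jacobian of $c$. A point is feasible if $c(x)=0$ and $x\ge0$. A point $x^*$ is a KKT point if there are $\lambda^*\in\mathbb{R}^m,\mu^*\in\mathbb{R}^n$ with $\nabla f(x^* )-\sum_j\lambda^*_j\nabla c_j(x^* )-\mu^*=0$, $c(x^* )=0$, $x^*\ge0$, $\mu^*\ge0$, $x_i^*\mu_i^*=0$ for all $i$. A feasible point $x$ satisfies MFCQ if the gradients $\nabla c_1(x),\dots,\nabla c_m(x)$ are linearly independent and there is $d\in\mathbb{R}^n$ with $\nabla c(x)^Td=0$ and $d_i>0$ whenever $x_i=0$. Subproblem $QP(x^{(k)},\Delta)$: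 $\min_d \tfrac12d^TW_1^{(k)}d+\nabla f(x^{(k)})^Td$ s.t. $c(x^{(k)})+\nabla c(x^{(k)})^Td=0$, $x^{(k)}+d\ge0$, $\|d\|_\infty\le\Delta$, where $W_1^{(k)}=\nabla^2f(x^{(k)})-\sum_j\lambda_j^{(k)}\nabla^2c_j(x^{(k)})$ and $\lambda^{(k)}$ is the current multiplier estimate ($QP(x,\Delta)$ at a general point $x$ is defined likewise). Predicted reduction: $\Delta m_f^{(k)}(d)=-\tfrac12d^TW_1^{(k)}d-\nabla f(x^{(k)})^Td$. Trust-region funnel SQP algorithm. Constants: $\beta,\kappa,\sigma,\delta\in(0,1)$, $\bar\tau>0$, $\bar\kappa>1$, $\Delta^\circ>0$. Start from $x^{(0)}\ge0$ with funnel width $\tau^{(0)}=\max[\bar\tau,\bar\kappa h^{(0)}]$. The algorithm stops if $x^{(k)}$ is a KKT point. At outer iteration $k$ (in the optimality phase), the inner loop starts from a trust-region radius $\Delta\ge\Delta^\circ$ and repeats: (a) If $QP(x^{(k)},\Delta)$ is infeasible, the inner loop ends, set $x^{\mathrm{resto}}=x^{(k)}$ and switch to the restoration phase. (b) Otherwise let $d$ be a global solution of $QP(x^{(k)},\Delta)$. If $d=0$, stop (KKT point found). Else put $\hat x=x^{(k)}+d$. (c) If $h(\hat x)\le\tau^{(k)}$ and $\Delta m_f^{(k)}(d)\ge\delta(h^{(k)})^2$ (switching condition): accept $\hat x$ if $f^{(k)}-f(\hat x)\ge\sigma\Delta m_f^{(k)}(d)$ ($f$-type step; $\tau^{(k+1)}=\tau^{(k)}$).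 (d) If $h(\hat x)\le\tau^{(k)}$, the switching condition fails, and $h(\hat x)\le\beta\tau^{(k)}$: accept $\hat x$ ($h$-type step) and set $\tau^{(k+1)}=(1-\kappa)h(\hat x)+\kappa\tau^{(k)}$. (e) If $\hat x$ was not accepted, replace $\Delta$ by $\tfrac12\min(\Delta,\|d\|_\infty)$ and repeat. If $\hat x$ is accepted, the inner loop ends and $x^{(k+1)}=\hat x$, with the multiplier estimates updated to those returned by the subproblem. Restoration phase: starting from $x^{\mathrm{resto}}$, a method is applied to the feasibility problem $\min_x\|c(x)\|_1$ s.t. $x\ge0$ (steps being accepted under an Armijo sufficient decrease condition on $h$) until it finds a point $x\ge 0$ that is acceptable to the funnel in the sense $h(x)\le\beta\min(\tau^{(k)},h(x^{\mathrm{resto}}))$ and for which $QP(x,\Delta)$ is feasible for some $\Delta\ge\Delta^\circ$. Then $x^{(k+1)}=x$, $\tau^{(k+1)}=(1-\kappa)h(x)+\kappa\tau^{(k)}$, and the algorithm returns to the optimality phase. The convergence of the restoration phase itself is not analyzed: it is assumed that a convergent globalization is available for the feasibility problem, so that a restoration phase that does not return converges to an infeasible stationary point of the constraint violation. Standard assumptions: (1) all points attained by the algorithm lie in a nonempty compact set $X$; (2) $f$ and $c$ are twice continuously differentiable on an open set containing $X$; (3) the Hessian matrices of the objective and constraints are uniformly bounded on $X$: there is $M>0$ such that these Hessian matrices $H(x)$ satisfy $\|H(x)\|_2\le M$ for all $x\in X$.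
   Formalization: The formal theorem additionally assumes that the subproblem matrices W_1^(k) are uniformly bounded over all iterates; bounded Hessians of f and c alone do not suffice, since the multiplier estimates can be unbounded and the claim then fails. *)

(* Defs.v *)
From HB Require Import structures.
From mathcomp Require Import all_boot all_order all_algebra.
From mathcomp Require Import all_classical all_reals all_analysis.
Import Order.TTheory GRing.Theory Num.Theory.
Import numFieldNormedType.Exports.

Set Implicit Arguments.
Unset Strict Implicit.
Unset Printing Implicit Defensive.

Local Open Scope classical_set_scope.
Local Open Scope ring_scope.

(* Vectors of R^n are rows 'rV[R]_n.  The library norm `|d| on 'rV[R]_n is the
   infinity norm. *)

Section Vectors.
Context {R : realType}.

Definition dotp n (u v : 'rV[R]_n) : R := \sum_i u 0 i * v 0 i.

Definition norm1 n (v : 'rV[R]_n) : R := \sum_i `|v 0 i|.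

Definition norm2 n (v : 'rV[R]_n) : R := Num.sqrt (\sum_i v 0 i ^+ 2).

(* The spectral norm; v *m H^T is H applied to v. *)
Definition spectral_norm n (H : 'M[R]_n) : R :=
  sup [set norm2 (v *m H^T) | v in [set v : 'rV[R]_n | norm2 v <= 1]].

Definition nonneg n (x : 'rV[R]_n) : Prop := forall i, 0 <= x 0 i.

End Vectors.

Section Derivatives.
Context {R : realType} {n m : nat}.

Definition grad (g : 'rV[R]_n -> R) (x : 'rV[R]_n) : 'rV[R]_n :=
  \row_i 'D_(delta_mx 0 i) g x.

Definition hess (g : 'rV[R]_n -> R) (x : 'rV[R]_n) : 'M[R]_n :=
  \matrix_(i, j) 'D_(delta_mx 0 i) (fun y => grad g y 0 j) x.

Definition C2_on (O : set 'rV[R]_n) (g : 'rV[R]_n -> R) : Prop :=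
  forall x, O x ->
    [/\ differentiable g x, differentiable (grad g) x
      & {for x, continuous (hess g)}].

Definition constr (c : 'rV[R]_n -> 'rV[R]_m) (j : 'I_m) : 'rV[R]_n -> R :=
  fun x => c x 0 j.

(* The m x n Jacobian, with rows grad c_j; it acts on d as d *m (jac c x)^T. *)
Definition jac (c : 'rV[R]_n -> 'rV[R]_m) (x : 'rV[R]_n) : 'M[R]_(m, n) :=
  \matrix_(j < m) grad (constr c j) x.

End Derivatives.

Section Problem.
Context {R : realType} {n m : nat}.
Variables (f : 'rV[R]_n -> R) (c : 'rV[R]_n -> 'rV[R]_m).

Definition viol (x : 'rV[R]_n) : R := norm1 (c x).

Definition feasible (x : 'rV[R]_n) : Prop := c x = 0 /\ nonneg x.

Definition KKT (x : 'rV[R]_n) : Prop :=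
  exists (lam : 'rV[R]_m) (mu : 'rV[R]_n),
    [/\ grad f x - \sum_j lam 0 j *: grad (constr c j) x - mu = 0,
        c x = 0, nonneg x, nonneg mu & forall i, x 0 i * mu 0 i = 0].

Definition MFCQ (x : 'rV[R]_n) : Prop :=
  row_free (jac c x) /\
  exists d : 'rV[R]_n,
    d *m (jac c x)^T = 0 /\ forall i, x 0 i = 0 -> 0 < d 0 i.

(* First-order stationarity for min ||c(x)||_1 s.t. x >= 0: no admissible
   displacement decreases the linearized violation. *)
Definition viol_stationary (x : 'rV[R]_n) : Prop :=
  nonneg x /\
  forall d, nonneg (x + d) -> viol x <= norm1 (c x + d *m (jac c x)^T).

Definition model_hess (x : 'rV[R]_n) (lam : 'rV[R]_m) : 'M[R]_n :=
  hess f x - \sum_j lam 0 j *: hess (constr c j) x.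

Definition QP_feasible (x : 'rV[R]_n) (Delta : R) (d : 'rV[R]_n) : Prop :=
  [/\ c x + d *m (jac c x)^T = 0, nonneg (x + d) & `|d| <= Delta].

Definition QP_obj (x : 'rV[R]_n) (lam : 'rV[R]_m) (d : 'rV[R]_n) : R :=
  2^-1 * dotp d (d *m (model_hess x lam)^T) + dotp (grad f x) d.

Definition QP_solution (x : 'rV[R]_n) (lam : 'rV[R]_m) (Delta : R)
    (d : 'rV[R]_n) : Prop :=
  QP_feasible x Delta d /\
  forall d', QP_feasible x Delta d' -> QP_obj x lam d <= QP_obj x lam d'.

(* lam' is a multiplier of the linearized equality constraints at the solution
   d of the subproblem; mu belongs to x + d >= 0, and nup, num to the two sides
   d <= Delta, d >= - Delta of the trust region. *)
Definition QP_multiplier (x : 'rV[R]_n) (lam : 'rV[R]_m) (Delta : R)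
    (d : 'rV[R]_n) (lam' : 'rV[R]_m) : Prop :=
  exists mu nup num : 'rV[R]_n,
    [/\ d *m (model_hess x lam)^T + grad f x
          - \sum_j lam' 0 j *: grad (constr c j) x - mu + nup - num = 0,
        [/\ nonneg mu, nonneg nup & nonneg num],
        forall i, (x + d) 0 i * mu 0 i = 0
      & forall i, (Delta - d 0 i) * nup 0 i = 0 /\
                  (Delta + d 0 i) * num 0 i = 0].

Definition pred_red (x : 'rV[R]_n) (lam : 'rV[R]_m) (d : 'rV[R]_n) : R :=
  - QP_obj x lam d.

End Problem.

Record funnel_constants (R : realType) := FunnelConstants {
  fc_beta : R;
  fc_kappa : R;
  fc_sigma : R;
  fc_delta : R;
  fc_taubar : R;
  fc_kappabar : R;
  fc_Delta0 : R   (* the lower bound on the initial radii, Delta^o *)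
}.

Definition valid_constants (R : realType) (P : funnel_constants R) : Prop :=
  [/\ 0 < fc_beta P < 1, 0 < fc_kappa P < 1, 0 < fc_sigma P < 1
    & 0 < fc_delta P < 1] /\
  [/\ 0 < fc_taubar P, 1 < fc_kappabar P & 0 < fc_Delta0 P].

Section Algorithm.
Context {R : realType} {n m : nat}.
Variables (f : 'rV[R]_n -> R) (c : 'rV[R]_n -> 'rV[R]_m).
Variable P : funnel_constants R.
Local Notation beta := (fc_beta P).
Local Notation kappa := (fc_kappa P).
Local Notation sigma := (fc_sigma P).
Local Notation delta := (fc_delta P).
Local Notation h := (viol c).

(* The algorithm is a nondeterministic transition system on these states. *)
Inductive state :=
| Outer (x : 'rV[R]_n) (lam : 'rV[R]_m) (tau : R)
    (* start of an outer iteration; the points x are the iterates x^(k) *)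
| Inner (x : 'rV[R]_n) (lam : 'rV[R]_m) (tau : R) (Delta : R)
    (* about to solve QP(x, Delta) *)
| Resto (xr : 'rV[R]_n) (tau : R) (z : 'rV[R]_n)
    (* restoration phase started at xr, currently at z *)
| Stopped (x : 'rV[R]_n).

Definition current_point (s : state) : 'rV[R]_n :=
  match s with
  | Outer x _ _ => x
  | Inner x _ _ _ => x
  | Resto _ _ z => z
  | Stopped x => x
  end.

Definition is_outer (s : state) : Prop :=
  if s is Outer _ _ _ then True else False.

Definition switching (x : 'rV[R]_n) (lam : 'rV[R]_m) (d : 'rV[R]_n) : Prop :=
  delta * h x ^+ 2 <= pred_red f c x lam d.

Definition f_type (x : 'rV[R]_n) (lam : 'rV[R]_m) (tau : R) (d : 'rV[R]_n)
    : Prop :=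
  [/\ h (x + d) <= tau, switching x lam d
    & sigma * pred_red f c x lam d <= f x - f (x + d)].

Definition h_type (x : 'rV[R]_n) (lam : 'rV[R]_m) (tau : R) (d : 'rV[R]_n)
    : Prop :=
  [/\ h (x + d) <= tau, ~ switching x lam d & h (x + d) <= beta * tau].

Definition new_width (tau : R) (x : 'rV[R]_n) : R :=
  (1 - kappa) * h x + kappa * tau.

Definition resto_success (xr : 'rV[R]_n) (tau : R) (z : 'rV[R]_n) : Prop :=
  [/\ nonneg z, h z <= beta * Num.min tau (h xr)
    & exists2 Delta, fc_Delta0 P <= Delta & exists d, QP_feasible c z Delta d].

(* Armijo sufficient decrease with respect to the linearized violation. *)
Definition resto_move (z z' : 'rV[R]_n) : Prop :=
  let pred := h z - norm1 (c z + (z' - z) *m (jac c z)^T) in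
  [/\ nonneg z', 0 <= pred & sigma * pred <= h z - h z'].

Inductive step : state -> state -> Prop :=
| step_KKT x lam tau :
    KKT f c x -> step (Outer x lam tau) (Stopped x)
| step_start x lam tau Delta :
    ~ KKT f c x -> fc_Delta0 P <= Delta ->
    step (Outer x lam tau) (Inner x lam tau Delta)
| step_infeasible x lam tau Delta :
    ~ (exists d, QP_feasible c x Delta d) ->
    step (Inner x lam tau Delta) (Resto x tau x)
| step_zero x lam tau Delta :
    QP_solution f c x lam Delta 0 ->
    step (Inner x lam tau Delta) (Stopped x)
| step_f x lam tau Delta d lam' :
    QP_solution f c x lam Delta d -> d <> 0 ->
    f_type x lam tau d -> QP_multiplier f c x lam Delta d lam' ->
    step (Inner x lam tau Delta) (Outer (x + d) lam' tau)
| step_h x lam tau Delta d lam' :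
    QP_solution f c x lam Delta d -> d <> 0 ->
    h_type x lam tau d -> QP_multiplier f c x lam Delta d lam' ->
    step (Inner x lam tau Delta) (Outer (x + d) lam' (new_width tau (x + d)))
| step_reject x lam tau Delta d :
    QP_solution f c x lam Delta d -> d <> 0 ->
    ~ f_type x lam tau d -> ~ h_type x lam tau d ->
    step (Inner x lam tau Delta)
         (Inner x lam tau (2^-1 * Num.min Delta `|d|))
| step_resto xr tau z z' :
    ~ resto_success xr tau z -> resto_move z z' ->
    step (Resto xr tau z) (Resto xr tau z')
| step_return xr tau z lam' :
    (* no rule is prescribed for the multiplier estimate after restoration *)
    resto_success xr tau z ->
    step (Resto xr tau z) (Outer z lam' (new_width tau z))
| step_stopped x : step (Stopped x) (Stopped x).

Definition run (s : nat -> state) : Prop :=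
  (exists x0 lam0,
     nonneg x0 /\
     s 0%N = Outer x0 lam0
               (Num.max (fc_taubar P) (fc_kappabar P * h x0))) /\
  forall i, step (s i) (s i.+1).

(* The assumption on the method used for restoration. *)
Definition resto_convergent (s : nat -> state) : Prop :=
  forall i0 xr tau,
    (forall i, (i0 <= i)%N -> exists z, s i = Resto xr tau z) ->
    exists z : 'rV[R]_n,
      [/\ current_point (s i) @[i --> \oo] --> z, ~ feasible c z
        & viol_stationary c z].

Definition bounded_hessians (X : set 'rV[R]_n) (M : R) : Prop :=
  forall x, X x ->
    spectral_norm (hess f x) <= M /\
    forall j, spectral_norm (hess (constr c j) x) <= M.

(* Boundedness of the matrices W_1^(k).  They involve the multiplier estimates,
   which a bound on the Hessians of f and c_j does not control: when the linear
   constraints meet the trust region only in a corner, the set of multipliers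
   of the subproblem can be unbounded. *)
Definition bounded_model_hessians (s : nat -> state) (M : R) : Prop :=
  forall i x lam tau, s i = Outer x lam tau ->
    spectral_norm (model_hess f c x lam) <= M.

Definition outcome_resto_failure (s : nat -> state) : Prop :=
  exists i0 xr tau,
    (forall i, (i0 <= i)%N ->
       exists2 z, s i = Resto xr tau z & ~ resto_success xr tau z) /\
    exists z : 'rV[R]_n,
      current_point (s i) @[i --> \oo] --> z /\ ~ feasible c z.

(* A run stops either on the KKT test or because d = 0 solves the subproblem. *)
Definition outcome_KKT (s : nat -> state) : Prop :=
  exists i x,
    [/\ s i.+1 = Stopped x, KKT f c x
      & (exists lam tau, s i = Outer x lam tau) \/
        (exists lam tau Delta,
           s i = Inner x lam tau Delta /\ QP_solution f c x lam Delta 0)].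

(* Restricting \oo to the outer states makes the cluster set that of the
   iterates x^(k); it is empty when there are finitely many of them. *)
Definition accumulation_point (s : nat -> state) (x : 'rV[R]_n) : Prop :=
  cluster (current_point (s i) @[i --> within [set j | is_outer (s j)] \oo]) x.

Definition outcome_accumulation (s : nat -> state) : Prop :=
  exists x, [/\ accumulation_point s x, feasible c x
              & KKT f c x \/ ~ MFCQ c x].

End Algorithm.

(* Main.v *)
Require Import Defs.
From HB Require Import structures.
From mathcomp Require Import all_boot all_order all_algebra.
From mathcomp Require Import all_classical all_reals all_analysis.
From mathcomp Require Import ring lra zify.
Import Order.TTheory GRing.Theory Num.Theory.
Import numFieldNormedType.Exports.
Set Implicit Arguments.
Unset Strict Implicit.
Unset Printing Implicit Defensive.
Local Open Scope classical_set_scope.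
Local Open Scope ring_scope.

(** Let [x] be a feasible point that is not a KKT point. Farkas' lemma gives a
    direction of first-order decrease of [f] that respects the linearized
    constraints at [x] ([not_KKT_descent]). Hence the subproblem at [x] promises
    a reduction at least proportional to the trust-region radius, for all small
    radii ([qp_descent_feasible]). Under MFCQ the direction can be made
    strictly interior to the active bounds, and the promise extends to all
    nonnegative points [y] near [x] and all radii [D] with
    [mu * h(y) <= D <= kap]: part of the radius is spent on cancelling the
    violation of [y] ([qp_descent_MFCQ]).

    Such a promise controls the inner loop ([inner_step_near]). Since [f] and
    [c] are strictly differentiable at [x], a step [d] of length at most [D]
    has [h(y + d) <= a * D] and an actual reduction of at least [sigma] times
    the predicted one, for any prescribed [a > 0], once [D] is small and [y] is
    near [x]. So all radii between [mu * h(y)] and [min(q, tau / a)] lead to an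
    f-type step. A rejected step is not much shorter than the smaller of the
    radius and this upper end, so the new radius is at least a fixed fraction
    [cc] of the upper end; as [h(y) <= tau], choosing [a] small makes
    [mu * h(y)] smaller than that. The radius therefore never falls below the
    good range: restoration and h-type steps do not occur, and the f-type step
    that ends the loop decreases [f] by an amount that depends on [tau] only.

    Consider now a run. If it stops, it stops at a KKT point. If it has finitely
    many outer iterations, it stays in restoration, because an endless inner loop
    would shrink the radius to zero while keeping the subproblem feasible, which
    forces its base point to be feasible and contradicts the preceding paragraph
    ([inner_terminates]). Otherwise there are infinitely many outer iterations.
    If the funnel shrinks infinitely often, its width and the violations tend to
    zero, and the iterates from which a shrinking step is taken accumulate at a
    feasible point ([outcome_shrinking]). If not, only f-type steps are taken
    eventually, [f] decreases to a limit, and by the switching condition the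
    violations tend to zero again ([outcome_constant]). In both cases an
    accumulation point that satisfies MFCQ without being a KKT point is
    impossible: near it each outer iteration takes an f-type step with a decrease
    of [f] that is fixed as long as [tau] is. *)

(** * Norm estimates and Farkas' lemma *)

Section VectorFacts.
Context {R : realType}.

Lemma norm_entry_le p q (A : 'M[R]_(p, q)) i j : `|A i j| <= `|A|.
Proof.
rewrite [leRHS]/Num.Def.normr /= mx_normrE.
by rewrite (bigD1 (i, j)) //= le_max lexx.
Qed.

Lemma norm_le_entries p q (A : 'M[R]_(p, q)) e : 0 <= e ->
  (forall i j, `|A i j| <= e) -> `|A| <= e.
Proof.
move=> e0 Ae; rewrite [leLHS]/Num.Def.normr /= mx_normrE.
elim/big_ind: _ => //= x y xe ye.
by rewrite ge_max xe ye.
Qed.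

Lemma dotpDr n (u v w : 'rV[R]_n) : dotp u (v + w) = dotp u v + dotp u w.
Proof. by rewrite -big_split; apply: eq_bigr => i _; rewrite mxE mulrDr. Qed.

Lemma dotpZr n a (u v : 'rV[R]_n) : dotp u (a *: v) = a * dotp u v.
Proof.
by rewrite mulr_sumr; apply: eq_bigr => i _; rewrite mxE mulrCA.
Qed.

Lemma dotpC n (u v : 'rV[R]_n) : dotp u v = dotp v u.
Proof. by apply: eq_bigr => i _; rewrite mulrC. Qed.

Lemma dotpBl n (u v w : 'rV[R]_n) : dotp (u - v) w = dotp u w - dotp v w.
Proof. by rewrite -sumrB; apply: eq_bigr => i _; rewrite !mxE mulrBl. Qed.

Lemma dotp_bound n (u v : 'rV[R]_n) : `|dotp u v| <= n%:R * `|u| * `|v|.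
Proof.
apply: le_trans (ler_norm_sum _ _ _) _.
rewrite -mulrA mulr_natl -[X in _ *+ X]card_ord -sumr_const.
by apply: ler_sum => i _; rewrite normrM ler_pM ?norm_entry_le.
Qed.

Lemma mulmx_bound n p (v : 'rV[R]_n) (A : 'M[R]_(n, p)) :
  `|v *m A| <= n%:R * `|A| * `|v|.
Proof.
apply: norm_le_entries => [|i j]; first by rewrite !mulr_ge0.
rewrite mxE; apply: le_trans (ler_norm_sum _ _ _) _.
rewrite -mulrA mulr_natl -[X in _ *+ X]card_ord -sumr_const.
by apply: ler_sum => k _; rewrite normrM mulrC ler_pM ?norm_entry_le.
Qed.

Lemma norm1_ge0 n (v : 'rV[R]_n) : 0 <= norm1 v.
Proof. exact: sumr_ge0. Qed.

Lemma norm_le_norm1 n (v : 'rV[R]_n) : `|v| <= norm1 v.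
Proof.
apply: norm_le_entries => [|i j]; first exact: norm1_ge0.
by rewrite (ord1 i) /norm1 (bigD1 j) //= lerDl sumr_ge0.
Qed.

Lemma norm1_le n (v : 'rV[R]_n) : norm1 v <= n%:R * `|v|.
Proof.
rewrite mulr_natl -[X in _ *+ X]card_ord -sumr_const.
by apply: ler_sum => i _; exact: norm_entry_le.
Qed.

Lemma norm2_ge0 n (v : 'rV[R]_n) : 0 <= norm2 v.
Proof. exact: sqrtr_ge0. Qed.

Lemma norm_le_norm2 n (v : 'rV[R]_n) : `|v| <= norm2 v.
Proof.
apply: norm_le_entries => [|i j]; first exact: norm2_ge0.
rewrite (ord1 i) -sqrtr_sqr ler_wsqrtr // (bigD1 j) //= lerDl.
by apply: sumr_ge0 => k _; exact: sqr_ge0.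
Qed.

Lemma norm2_le n (v : 'rV[R]_n) e : `|v| <= e -> norm2 v <= Num.sqrt (n%:R * e ^+ 2).
Proof.
move=> ve; apply: ler_wsqrtr.
rewrite mulr_natl -[X in _ *+ X]card_ord -sumr_const.
apply: ler_sum => i _; rewrite -real_normK ?num_real //.
rewrite lerXn2r ?nnegrE ?(le_trans _ ve) //.
exact: norm_entry_le.
Qed.

(** Testing the spectral norm on the unit vectors bounds every entry. *)
Lemma spectral_entry_le n (W : 'M[R]_n) i j : `|W i j| <= spectral_norm W.
Proof.
have dj1 : norm2 (delta_mx 0 j : 'rV[R]_n) <= 1.
  rewrite /norm2 (bigD1 j) //= mxE !eqxx expr1n big1 ?addr0 ?sqrtr1 //.
  by move=> k /negbTE kj; rewrite mxE kj andbF expr0n.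
apply: le_trans (_ : norm2 ((delta_mx 0 j : 'rV[R]_n) *m W^T) <= _).
  rewrite -rowE; apply: (le_trans _ (norm_le_norm2 _)).
  by have := norm_entry_le (row j W^T) 0 i; rewrite !mxE.
apply: ub_le_sup; last by exists (delta_mx 0 j).
exists (Num.sqrt (n%:R * (n%:R * `|W^T|) ^+ 2)) => _ [v v1 <-].
apply: norm2_le; apply: le_trans (mulmx_bound _ _) _.
by rewrite ler_piMr ?mulr_ge0 //; exact: le_trans (norm_le_norm2 v) v1.
Qed.

Lemma quad_bound n (W : 'M[R]_n) K (d : 'rV[R]_n) : spectral_norm W <= K ->
  `|dotp d (d *m W^T)| <= n%:R ^+ 2 * `|K| * `|d| ^+ 2.
Proof.
move=> WK; apply: le_trans (dotp_bound _ _) _.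
have W_le : `|W^T| <= `|K|.
  apply: norm_le_entries => // i j; rewrite mxE.
  by apply: le_trans (spectral_entry_le W _ _) (le_trans WK (ler_norm K)).
have -> : n%:R ^+ 2 * `|K| * `|d| ^+ 2 = n%:R * `|d| * (n%:R * `|K| * `|d|) by ring.
rewrite ler_wpM2l ?mulr_ge0 //; apply: le_trans (mulmx_bound _ _) _.
by rewrite ler_wpM2r // ler_wpM2l.
Qed.

(** Induction on the number of constraints: if dropping the last
    constraint admits a direction [x'] violating the conclusion, then
    [x'] must violate that constraint, and projecting along [x'] onto its
    kernel reduces the claim to one constraint fewer. *)
Lemma farkas n N (a : 'I_N -> 'rV[R]_n) (g : 'rV[R]_n) :
  (forall x, (forall i, 0 <= dotp (a i) x) -> 0 <= dotp g x) ->
  exists2 y : 'I_N -> R, (forall i, 0 <= y i) & g = \sum_i y i *: a i.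
Proof.
elim: N a g => [|N IH] a g ga.
  exists (fun=> 0) => //; rewrite big_ord0; apply/rowP => j.
  have d i (b : R) : dotp g (b *: delta_mx 0 i) = b * g 0 i.
    rewrite dotpZr /dotp (bigD1 i) //= big1 ?addr0 ?mxE ?eqxx ?mulr1 // => k.
    by move=> /negbTE ki; rewrite mxE ki andbF mulr0.
  have p := ga (1 *: delta_mx 0 j) (fun i => ltac:(by case: i)).
  have m := ga (- 1 *: delta_mx 0 j) (fun i => ltac:(by case: i)).
  by move: p m; rewrite !d mxE; lra.
pose l := a ord_max; pose b i := a (widen_ord (leqnSn N) i).
have [gb|] := pselect (forall x, (forall i, 0 <= dotp (b i) x) -> 0 <= dotp g x).
  have [y y0 ->] := IH b g gb.
  exists (fun i => if unlift ord_max i is Some k then y k else 0) => [i|].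
    by case: unliftP.
  rewrite big_ord_recr /= unlift_none scale0r addr0.
  apply: eq_bigr => i _; congr (_ *: _).
  have -> : widen_ord (leqnSn N) i = lift ord_max i.
    by apply: val_inj; rewrite /= /bump leqNgt ltn_ord.
  by rewrite liftK.
move=> /existsNP [x0 /not_implyP [bx0 /negP]]; rewrite -ltNge => gx0.
have lx0 : dotp l x0 < 0.
  rewrite ltNge; apply: contraTN gx0 => lx0; rewrite -leNgt; apply: ga => i.
  have [k ->|->//] := unliftP ord_max i.
  have -> : lift ord_max k = widen_ord (leqnSn N) k; last exact: bx0.
  by apply: val_inj; rewrite /= /bump leqNgt ltn_ord.
pose x' := (- dotp l x0)^-1 *: x0.
have c0 : 0 < (- dotp l x0)^-1 by rewrite invr_gt0 oppr_gt0.
have lx' : dotp l x' = - 1.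
  by rewrite dotpZr invrN mulNr mulVf ?lt_eqF.
have bx' i : 0 <= dotp (b i) x' by rewrite dotpZr mulr_ge0 // ltW.
have gx' : dotp g x' < 0 by rewrite dotpZr pmulr_rlt0.
pose pr v := v + dotp v x' *: l.
have prE v x : dotp (pr v) x = dotp v (x + dotp l x *: x').
  rewrite dotpC dotpDr dotpZr dotpDr dotpZr !(dotpC x); ring.
have [|y y0 gE] := IH (pr \o b) (pr g).
  move=> x bx; rewrite prE; apply: ga => i.
  have [k ->|->] := unliftP ord_max i; last first.
    by rewrite -/l dotpDr dotpZr lx'; lra.
  have -> : lift ord_max k = widen_ord (leqnSn N) k; last by rewrite -prE; exact: (bx k).
  by apply: val_inj; rewrite /= /bump leqNgt ltn_ord.
exists (fun i => if unlift ord_max i is Some k then y k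
                 else \sum_k y k * dotp (b k) x' - dotp g x') => [i|].
  case: unliftP => // _; rewrite subr_ge0; apply: le_trans (ltW gx') _.
  by apply: sumr_ge0 => k _; rewrite mulr_ge0.
rewrite big_ord_recr /= unlift_none -/l.
transitivity (pr g - dotp g x' *: l); first by rewrite addrK.
rewrite gE scalerBl addrA; congr (_ - _).
rewrite scaler_suml -big_split; apply: eq_bigr => k _ /=.
have -> : widen_ord (leqnSn N) k = lift ord_max k.
  by apply: val_inj; rewrite /= /bump leqNgt ltn_ord.
rewrite liftK -scalerA -scalerDr; congr (_ *: (_ + _)).
by rewrite /b; congr a; apply: val_inj; rewrite /= /bump leqNgt ltn_ord.
Qed.

End VectorFacts.

(** * First-order tools: KKT alternative and strict differentiability *)

Section FirstOrder.
Context {R : realType} {n m : nat}.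
Implicit Types (f g : 'rV[R]_n -> R) (c : 'rV[R]_n -> 'rV[R]_m) (x d : 'rV[R]_n).

Lemma mul_jacE c x d j : (d *m (jac c x)^T) 0 j = dotp (grad (constr c j) x) d.
Proof. by rewrite mxE; apply: eq_bigr => i _; rewrite !mxE mulrC. Qed.

(** The KKT conditions at a feasible point say that the gradient of [f] is
    dual to the cone of directions allowed by the linearized constraints. By
    Farkas' lemma their failure is witnessed by a direction of that cone. *)
Lemma not_KKT_descent f c x : c x = 0 -> nonneg x -> ~ KKT f c x ->
  exists s, [/\ s *m (jac c x)^T = 0, forall i, x 0 i = 0 -> 0 <= s 0 i
              & dotp (grad f x) s < 0].
Proof.
move=> cx x0 nK; apply: contrapT => /forallNP noS; apply: nK.
pose gc j := grad (constr c j) x.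
(* Each equality constraint enters the cone as two opposite inequalities. *)
pose act i : 'rV[R]_n := if x 0 i == 0 then delta_mx 0 i else 0.
pose a (i : 'I_(m + (m + n))) := match fintype.split i with
  | inl j => gc j
  | inr k => match fintype.split k with inl j => - gc j | inr l => act l end end.
have dotp_act i s : x 0 i = 0 -> dotp (act i) s = s 0 i.
  move=> xi; rewrite /act xi eqxx /dotp (bigD1 i) //= mxE !eqxx mul1r.
  by rewrite big1 ?addr0 // => k /negbTE ki; rewrite mxE ki andbF mul0r.
have [s as0|y y0 gE] := farkas (a := a) (g := grad f x).
  rewrite leNgt; apply/negP => gs; apply: (noS s); split=> //.
  - apply/rowP => j; rewrite mul_jacE mxE -/(gc j).
    have := as0 (lshift _ j); rewrite /a (unsplitK (inl _ j)).
    have := as0 (rshift m (lshift n j)).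
    rewrite /a (unsplitK (inr _ (lshift n j))) (unsplitK (inl _ j)).
    rewrite -[- gc j]sub0r dotpBl {1}/dotp big1; first lra.
    by move=> k _; rewrite mxE mul0r.
  - move=> i xi; have := as0 (rshift m (rshift m i)).
    by rewrite /a (unsplitK (inr _ (rshift m i))) (unsplitK (inr _ i)) dotp_act.
exists (\row_j (y (lshift _ j) - y (rshift m (lshift n j)))).
exists (\row_i (if x 0 i == 0 then y (rshift m (rshift m i)) else 0)).
split => //; last 2 first.
- by move=> i; rewrite mxE; case: eqP.
- by move=> i; rewrite mxE; case: eqP => [->|]; rewrite ?mul0r ?mulr0.
rewrite gE !big_split_ord /=.
have -> : \sum_(i < m) y (lshift (m + n) i) *: a (lshift (m + n) i)
        = \sum_(i < m) y (lshift (m + n) i) *: gc i.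
  by apply: eq_bigr => i _; rewrite /a (unsplitK (inl _ i)).
have -> : \sum_(i < m) y (rshift m (lshift n i)) *: a (rshift m (lshift n i))
        = - \sum_(i < m) y (rshift m (lshift n i)) *: gc i.
  rewrite -sumrN; apply: eq_bigr => i _.
  by rewrite /a (unsplitK (inr _ (lshift n i))) (unsplitK (inl _ i)) scalerN.
have -> : \sum_(i < n) y (rshift m (rshift m i)) *: a (rshift m (rshift m i))
        = \row_i (if x 0 i == 0 then y (rshift m (rshift m i)) else 0).
  rewrite [RHS]row_sum_delta; apply: eq_bigr => i _.
  rewrite /a (unsplitK (inr _ (rshift m i))) (unsplitK (inr _ i)) /act mxE.
  by case: eqP => _; rewrite ?scaler0 ?scale0r.
under [X in _ - X - _]eq_bigr do rewrite mxE scalerBl -/(gc _).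
rewrite sumrB !opprB !addrA; apply/rowP => i; rewrite !mxE; ring.
Qed.

Lemma derive_gradE g x d : differentiable g x -> 'D_d g x = dotp (grad g x) d.
Proof.
move=> dg; rewrite deriveE // {1}[d]row_sum_delta linear_sum /dotp.
by apply: eq_bigr => i _; rewrite linearZ /= mxE deriveE // mulrC.
Qed.

(** By the mean value theorem the remainder is the variation of the gradient
    along the segment, which its continuity at [x] bounds for all
    segments near [x] at once. *)
Lemma strict_differentiability (O : set 'rV[R]_n) g x (e : R) : open O -> O x ->
  C2_on O g -> 0 < e ->
  exists2 r, 0 < r & forall y d, `|y - x| < r -> `|d| <= r ->
    `|g (y + d) - g y - dotp (grad g y) d| <= e * `|d|.
Proof.
move=> oO Ox C2g e0.
pose e' := e / (2 * n.+1%:R).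
have e'0 : 0 < e' by rewrite divr_gt0 // mulr_gt0.
have [_ /differentiable_continuous gc _] := C2g x Ox.
have /nbhs_normP[r1 /= r10 gr1] : \forall y \near x, `|grad g x - grad g y| < e'.
  by move/cvgrPdist_lt: gc; exact.
have /nbhs_normP[r2 /= r20 Or2] : nbhs x O by exact: open_nbhs_nbhs.
pose r := Num.min r1 r2 / 2.
have r12 : 0 < Num.min r1 r2 by rewrite lt_min r10 r20.
exists r => [|y d yx dr]; first by rewrite divr_gt0.
have seg (t : R) : 0 <= t <= 1 -> `|x - (y + t *: d)| < Num.min r1 r2.
  move=> /andP[t0 t1]; rewrite opprD addrA; apply: le_lt_trans (ler_normB _ _) _.
  rewrite distrC normrZ ger0_norm // (splitr (Num.min r1 r2)).
  by apply: ltr_leD => //; apply: le_trans dr; rewrite ler_piMl.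
have gd (t : R) : 0 <= t <= 1 -> `|grad g (y + t *: d) - grad g x| < e'.
  move=> /seg tr; rewrite distrC; apply: gr1.
  by rewrite /ball_ /=; apply: lt_le_trans tr _; rewrite ge_min lexx.
have gdiff (t : R) : 0 <= t <= 1 -> differentiable g (y + t *: d).
  move=> /seg tr; suff /C2g[] : O (y + t *: d) by [].
  by apply: Or2; rewrite /ball_ /=; apply: lt_le_trans tr _; rewrite ge_min lexx orbT.
pose phi t := g (y + t *: d).
have dphi (t : R) : 0 <= t <= 1 -> is_derive t (1 : R) phi (dotp (grad g (y + t *: d)) d).
  move=> t01; have dg := gdiff _ t01.
  (* The two difference quotients are the same function of [h]. *)
  have E : (fun h : R => h^-1 *: ((phi \o shift t) (h *: 1) - phi t)) =
           (fun h : R => h^-1 *: ((g \o shift (y + t *: d)) (h *: d) - g (y + t *: d))).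
    apply/funext => h; rewrite /phi /= /shift; congr (_ *: (g _ - _)).
    by rewrite [h *: 1]mulr1 scalerDl addrCA.
  apply: DeriveDef.
    by rewrite /derivable E; exact: diff_derivable.
  by rewrite /derive E -derive_gradE.
have [||t t01] := @MVT R phi (fun t => dotp (grad g (y + t *: d)) d) 0 1 ltr01.
- by move=> t; rewrite in_itv /= => /andP[t0 t1]; apply: dphi; rewrite !ltW.
- apply: derivable_within_continuous => t; rewrite in_itv /= => t01.
  by have [] := dphi t t01.
rewrite /phi scale1r scale0r addr0 subr0 mulr1 => ->.
rewrite -dotpBl; apply: le_trans (dotp_bound _ _) _; rewrite ler_wpM2r //.
have -> : grad g (y + t *: d) - grad g y =
   (grad g (y + t *: d) - grad g x) - (grad g (y + 0 *: d) - grad g x).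
  by rewrite scale0r addr0 opprB addrA subrK.
apply: le_trans (_ : n.+1%:R * (e' + e') <= _); last first.
  have -> : n.+1%:R * (e' + e') = e by rewrite /e'; field; rewrite nat1r pnatr_eq0.
  exact: lexx.
apply: ler_pM => //; first by rewrite ler_nat.
move: t01; rewrite in_itv /= => /andP[t0 t1].
apply: le_trans (ler_normB _ _) _; rewrite lerD // ltW // gd ?lexx ?ler01 //.
by rewrite !ltW.
Qed.

End FirstOrder.

(** * Linear predicted reduction near a non-KKT point *)

Section Local.
Context {R : realType} {n m : nat}.
Implicit Types (f g : 'rV[R]_n -> R) (c : 'rV[R]_n -> 'rV[R]_m) (x y d : 'rV[R]_n).

Lemma near_right_mul (C e : R) : 0 < e -> \forall r \near (0 : R)^'+, C * r <= e.
Proof.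
move=> e0; near=> r.
have r0 : 0 < r by near: r; exact: nbhs_right_gt.
have C0 : 0 < 1 + `|C| by rewrite ltr_pwDl.
apply: (@le_trans _ _ ((1 + `|C|) * r)).
  by rewrite ler_wpM2r ?(ltW r0) // ler_wpDl // ler_norm.
rewrite mulrC -ler_pdivlMr //; near: r; apply: nbhs_right_le.
by rewrite divr_gt0.
Unshelve. all: by end_near. Qed.

Lemma near_grad (O : set 'rV[R]_n) g x (e : R) : O x -> C2_on O g -> 0 < e ->
  \forall r \near (0 : R)^'+, forall y, `|y - x| <= r -> `|grad g y - grad g x| <= e.
Proof.
move=> Ox C2g e0; have [_ /differentiable_continuous gc _] := C2g x Ox.
have /nbhs_normP[r1 /= r10 gr1] : \forall y \near x, `|grad g x - grad g y| < e.
  by move/cvgrPdist_lt: gc; exact.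
near=> r => y yx; rewrite distrC ltW //; apply: gr1; rewrite /ball_ /= distrC.
by apply: le_lt_trans yx _; near: r; exact: nbhs_right_lt.
Unshelve. all: by end_near. Qed.

Lemma near_strict (O : set 'rV[R]_n) g x (e : R) : open O -> O x ->
  C2_on O g -> 0 < e ->
  \forall r \near (0 : R)^'+, forall y d, `|y - x| <= r -> `|d| <= r ->
    `|g (y + d) - g y - dotp (grad g y) d| <= e * `|d|.
Proof.
move=> oO Ox C2g e0; have [r0 r00 gr0] := strict_differentiability oO Ox C2g e0.
near=> r => y d yx dr.
have rr0 : r < r0 by near: r; exact: nbhs_right_lt.
by apply: gr0; [exact: le_lt_trans yx _|exact/ltW/(le_lt_trans dr)].
Unshelve. all: by end_near. Qed.

Lemma near_jac (O : set 'rV[R]_n) c x (e : R) : O x ->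
  (forall j, C2_on O (constr c j)) -> 0 < e ->
  \forall r \near (0 : R)^'+, forall y, `|y - x| <= r -> `|jac c y - jac c x| <= e.
Proof.
move=> Ox C2c e0.
have H : \forall r \near (0 : R)^'+, forall j y, `|y - x| <= r ->
    `|grad (constr c j) y - grad (constr c j) x| <= e.
  by apply: filter_forall => j; exact: near_grad (C2c j) e0.
near=> r => y yx; apply: norm_le_entries => [|j i]; first exact: ltW.
have := norm_entry_le (grad (constr c j) y - grad (constr c j) x) 0 i.
rewrite !mxE => /le_trans; apply.
have : forall j y, `|y - x| <= r ->
    `|grad (constr c j) y - grad (constr c j) x| <= e by near: r; exact: H.
exact.
Unshelve. all: by end_near. Qed.

Lemma near_strict_constraints (O : set 'rV[R]_n) c x (e : R) : open O -> O x ->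
  (forall j, C2_on O (constr c j)) -> 0 < e ->
  \forall r \near (0 : R)^'+, forall y d, `|y - x| <= r -> `|d| <= r ->
    norm1 (c (y + d) - c y - d *m (jac c y)^T) <= e * `|d|.
Proof.
move=> oO Ox C2c e0; pose e' := e / m.+1%:R.
have e'0 : 0 < e' by rewrite divr_gt0.
have H : \forall r \near (0 : R)^'+, forall j y d, `|y - x| <= r -> `|d| <= r ->
    `|constr c j (y + d) - constr c j y - dotp (grad (constr c j) y) d| <= e' * `|d|.
  by apply: filter_forall => j; exact: near_strict (C2c j) e'0.
near=> r => y d yx dr.
have Hr : forall j y d, `|y - x| <= r -> `|d| <= r ->
    `|constr c j (y + d) - constr c j y - dotp (grad (constr c j) y) d| <= e' * `|d|.
  by near: r; exact: H.
apply: le_trans (norm1_le _) _; apply: (@le_trans _ _ (m%:R * (e' * `|d|))).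
  rewrite ler_wpM2l //; apply: norm_le_entries => [|i j].
    by rewrite mulr_ge0 // ltW.
  have := Hr j y d yx dr; rewrite -(mul_jacE c y d j) (ord1 i).
  have subE (u v w : 'rV[R]_m) : (u - v - w) 0 j = u 0 j - v 0 j - w 0 j.
    by rewrite !mxE.
  by rewrite subE.
rewrite mulrA ler_wpM2r // /e' mulrCA ger_pMr // ler_pdivrMr // mul1r.
by rewrite ler_nat.
Unshelve. all: by end_near. Qed.

Lemma near_viol (O : set 'rV[R]_n) c x (e : R) : O x ->
  (forall j, C2_on O (constr c j)) -> 0 < e ->
  \forall r \near (0 : R)^'+, forall y, `|y - x| <= r -> `|viol c y - viol c x| <= e.
Proof.
move=> Ox C2c e0.
pose e' := e / m.+1%:R.
have e'0 : 0 < e' by rewrite divr_gt0.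
have H : \forall r \near (0 : R)^'+, forall j y, `|y - x| <= r ->
    `|constr c j x - constr c j y| <= e'.
  apply: filter_forall => j.
  have [/differentiable_continuous cj _ _] := C2c j x Ox.
  have /nbhs_normP[r1 /= r10 cr1] : \forall y \near x,
      `|constr c j x - constr c j y| < e'.
    by move/cvgrPdist_lt: cj; exact.
  near=> r => y yx; rewrite ltW //; apply: cr1; rewrite /ball_ /= distrC.
  by apply: le_lt_trans yx _; near: r; exact: nbhs_right_lt.
near=> r => y yx.
have Hr : forall j y, `|y - x| <= r -> `|constr c j x - constr c j y| <= e'.
  by near: r; exact: H.
rewrite /viol /norm1 -sumrB; apply: le_trans (ler_norm_sum _ _ _) _.
apply: (@le_trans _ _ (\sum_(j < m) e')).
  apply: ler_sum => j _; apply: le_trans (Hr j y yx); rewrite [leRHS]distrC.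
  exact: ler_dist_dist.
rewrite sumr_const card_ord -mulr_natl /e' mulrCA ger_pMr // ler_pdivrMr //.
by rewrite mul1r ler_nat.
Unshelve. all: by end_near. Qed.

(** The lower bound on the radius is what it costs to cancel the
    violation at [x]; above it the predicted reduction is linear in the radius. *)
Definition qp_descent (mu kap eta : R) f c x lam :=
  forall Delta, mu * viol c x <= Delta <= kap ->
    exists2 d, QP_feasible c x Delta d & QP_obj f c x lam d <= - eta * Delta.

Lemma QP_obj_linear f c x lam MW d :
  spectral_norm (model_hess f c x lam) <= MW ->
  `|QP_obj f c x lam d - dotp (grad f x) d| <= n%:R ^+ 2 * `|MW| * `|d| ^+ 2.
Proof.
move=> /quad_bound - /(_ d) Wd; rewrite /QP_obj addrK normrM.
apply: le_trans Wd; rewrite ler_piMl // ger0_norm ?invr_ge0 //.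
by rewrite invf_le1 // ler1n.
Qed.

Lemma near_positive_entries x (C : R) :
  \forall r \near (0 : R)^'+, forall i, 0 < x 0 i -> C * r <= x 0 i.
Proof.
apply: filter_forall => i; have [xi|xi] := ltP 0 (x 0 i).
  by near=> r => _; near: r; exact: near_right_mul.
by apply: nearW.
Unshelve. all: by end_near. Qed.

(** The gain along the direction of [not_KKT_descent] is linear in the
    radius; below a small enough radius the quadratic term costs at most half of
    it. *)
Lemma qp_descent_feasible f c x lam MW :
  c x = 0 -> nonneg x -> ~ KKT f c x ->
  spectral_norm (model_hess f c x lam) <= MW ->
  exists kap eta, [/\ 0 < kap, 0 < eta & qp_descent 1 kap eta f c x lam].
Proof.
move=> cx x0 nK WM; have [s [sJ sA gs]] := not_KKT_descent cx x0 nK.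
pose C := n%:R ^+ 2 * `|MW| * `|s| ^+ 2.
pose a := - dotp (grad f x) s; have a0 : 0 < a by rewrite oppr_gt0.
pose S := 1 + `|s|; have S0 : 0 < S by rewrite ltr_pwDl.
near (0 : R)^'+ => kap.
have k0 : 0 < kap by near: kap; exact: nbhs_right_gt.
have kx : forall i, 0 < x 0 i -> kap <= x 0 i.
  move=> i xi; rewrite -[kap]mul1r; move: i xi.
  by near: kap; exact: near_positive_entries.
have kC : C * kap <= a / 2.
  by near: kap; apply: near_right_mul; rewrite divr_gt0.
exists kap, (a / 2 / S); split=> //; first by rewrite !divr_gt0.
move=> D; rewrite mul1r /viol cx /norm1 big1 => [|i _]; last first.
  by rewrite mxE normr0.
move=> /andP[D0 Dk]; pose t := D / S.
have t0 : 0 <= t by rewrite divr_ge0 // ltW.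
have tD : t * S = D by rewrite divfK // gt_eqF.
have tk : t <= kap.
  by apply: le_trans Dk; rewrite -tD ler_peMr // lerDl.
have ts : t * `|s| <= D by rewrite -tD ler_wpM2l // lerDr.
exists (t *: s); first split.
- by rewrite cx add0r -scalemxAl sJ scaler0.
- move=> i; rewrite !mxE; have [xi|xi] := ltP 0 (x 0 i); last first.
    have xi0 : x 0 i = 0 by apply/eqP; rewrite eq_le xi x0.
    by rewrite xi0 add0r mulr_ge0 // sA.
  rewrite -lerBlDl sub0r -lerN2 opprK.
  apply: (@le_trans _ _ (t * `|s|)).
    rewrite -mulrN ler_wpM2l // (le_trans (ler_norm _)) // normrN.
    exact: norm_entry_le.
  by apply: le_trans ts (le_trans Dk (kx i xi)).
- by rewrite normrZ ger0_norm.
have := QP_obj_linear (t *: s) WM; rewrite ler_norml => /andP[_].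
rewrite lerBlDr normrZ (ger0_norm t0) => /le_trans; apply.
rewrite dotpZr exprMn.
have -> : n%:R ^+ 2 * `|MW| * (t ^+ 2 * `|s| ^+ 2) = t * (C * t).
  by rewrite /C; ring.
have -> : - (a / 2 / S) * D = t * - (a / 2) by rewrite /t; ring.
rewrite -mulrDr ler_wpM2l //.
have CC : C * t <= C * kap.
  by rewrite ler_wpM2l // /C !mulr_ge0 // exprn_ge0.
by move: kC CC; rewrite /a; lra.
Unshelve. all: by end_near. Qed.

(** A small multiple of the MFCQ direction added to a descent direction keeps
    the descent and makes all active components positive. *)
Lemma MFCQ_strict_descent f c x : c x = 0 -> nonneg x -> ~ KKT f c x ->
  MFCQ c x ->
  exists s, [/\ s *m (jac c x)^T = 0, forall i, x 0 i = 0 -> 0 < s 0 i,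
                dotp (grad f x) s < 0 & `|s| <= 2^-1].
Proof.
move=> cx x0 nK [_ [d [dJ dA]]].
have [s [sJ sA gs]] := not_KKT_descent cx x0 nK.
have a0 : 0 < - dotp (grad f x) s by rewrite oppr_gt0.
near (0 : R)^'+ => t.
have t0 : 0 < t by near: t; exact: nbhs_right_gt.
have tg : dotp (grad f x) d * t <= - dotp (grad f x) s / 2.
  by near: t; apply: near_right_mul; rewrite divr_gt0.
pose u := s + t *: d; pose k := (2 * (1 + `|u|))^-1.
have k0 : 0 < k by rewrite invr_gt0 mulr_gt0 // ltr_pwDl.
exists (k *: u); split.
- by rewrite -scalemxAl mulmxDl sJ -scalemxAl dJ !(scaler0, addr0).
- move=> i xi; rewrite mxE pmulr_rgt0 // !mxE ltr_wpDl ?sA //.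
  by rewrite mulr_gt0 // dA.
- rewrite dotpZr pmulr_rlt0 // dotpDr dotpZr mulrC.
  by move: tg gs; lra.
- rewrite normrZ gtr0_norm // /k invfM -mulrA ler_piMr ?invr_ge0 //.
  by rewrite mulrC ler_pdivrMr ?mul1r ?lerDr // ltr_pwDl.
Unshelve. all: by end_near. Qed.

(** On the kernel of [A] the hypothesis bounds the norm by half of itself. *)
Lemma near_one_unitmx p (A : 'M[R]_p) :
  (forall w : 'rV[R]_p, `|w *m A - w| <= 2^-1 * `|w|) ->
  A \in unitmx /\ forall w : 'rV[R]_p, `|w| <= 2 * `|w *m A|.
Proof.
move=> A1.
have wA (w : 'rV[R]_p) : `|w| <= 2 * `|w *m A|.
  have := A1 w; have := ler_normB (w *m A) (w *m A - w).
  by rewrite opprB addrC subrK; lra.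
split=> //; rewrite -row_free_unit; apply: inj_row_free => v vA.
by apply/eqP; rewrite -normr_le0; have := wA v; rewrite vA normr0 mulr0.
Qed.

(** The step [D *: s] along the strict descent direction leaves room of
    order [D] in the active bounds and in the objective; a correction of much
    smaller size, through a right inverse of the Jacobian that stays
    invertible near [x], restores the linearized constraints as soon as the
    violation is small relative to [D]. *)
Lemma qp_descent_MFCQ (O : set 'rV[R]_n) f c x MW : O x -> C2_on O f ->
  (forall j, C2_on O (constr c j)) ->
  c x = 0 -> nonneg x -> ~ KKT f c x -> MFCQ c x ->
  exists r mu kap eta, [/\ 0 < r, 0 < mu, 0 < kap, 0 < eta &
    forall y lam, nonneg y -> `|y - x| <= r ->
      spectral_norm (model_hess f c y lam) <= MW ->
      qp_descent mu kap eta f c y lam].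
Proof.
move=> Ox C2f C2c cx x0 nK mf; have [rf _] := mf.
have [s [sJ sA gs s2]] := MFCQ_strict_descent cx x0 nK mf.
have /row_freeP[B JB] := rf.
have BJ : B^T *m (jac c x)^T = 1%:M by rewrite -trmx_mul JB trmx1.
pose CB := 1 + m%:R * `|B^T|.
have CB0 : 0 < CB by rewrite ltr_pwDl // mulr_ge0.
have wB (w : 'rV[R]_m) : `|w *m B^T| <= CB * `|w|.
  by apply: le_trans (mulmx_bound _ _) _; rewrite ler_wpM2r // lerDr.
pose a := - dotp (grad f x) s; have a0 : 0 < a by rewrite oppr_gt0.
pose CW := n%:R ^+ 2 * `|MW|; pose G := n%:R * `|grad f x|.
(* [th * D] will bound the correction; it must not spoil the radius, the
   active bounds or the objective. *)
near (0 : R)^'+ => th.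
have th0 : 0 < th by near: th; exact: nbhs_right_gt.
have th2 : th <= 2^-1 by near: th; apply: nbhs_right_le.
have ths : forall i, x 0 i = 0 -> th <= s 0 i.
  move=> i /sA si; rewrite -[th]mul1r; move: i si.
  by near: th; exact: near_positive_entries.
have thG : G * th <= a / 4.
  by near: th; apply: near_right_mul; rewrite divr_gt0.
(* [e] bounds the variation of the first derivatives around [x]. *)
near (0 : R)^'+ => e.
have e0 : 0 < e by near: e; exact: nbhs_right_gt.
have eB : CB * n%:R * e <= th / 2.
  by near: e; apply: near_right_mul; rewrite divr_gt0.
have ea : n%:R * e <= a / 4.
  by near: e; apply: near_right_mul; rewrite divr_gt0.
near (0 : R)^'+ => kap.
have kap0 : 0 < kap by near: kap; exact: nbhs_right_gt.
have kx : forall i, 0 < x 0 i -> 2 * kap <= x 0 i.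
  by near: kap; exact: near_positive_entries.
have kC : CW * kap <= a / 4.
  by near: kap; apply: near_right_mul; rewrite divr_gt0.
near (0 : R)^'+ => r.
have r0 : 0 < r by near: r; exact: nbhs_right_gt.
have rk : r <= kap by near: r; exact: nbhs_right_le.
have rJ : forall y, `|y - x| <= r -> `|jac c y - jac c x| <= e.
  by near: r; exact: (near_jac Ox).
have rg : forall y, `|y - x| <= r -> `|grad f y - grad f x| <= e.
  by near: r; exact: (near_grad Ox).
exists r, (4 * CB / th), kap, (a / 4); split=> //; rewrite ?divr_gt0 ?mulr_gt0 //.
move=> y lam y0 yx WM D /andP[hD Dk].
have h0 : 0 <= viol c y by exact: norm1_ge0.
have D0 : 0 <= D by apply: le_trans hD; rewrite mulr_ge0 // ltW // divr_gt0 ?mulr_gt0.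
have hD' : 4 * CB * viol c y <= th * D.
  by move: hD; rewrite mulrAC ler_pdivrMr // [D * _]mulrC.
pose E := jac c y - jac c x.
have vE (v : 'rV[R]_n) : `|v *m E^T| <= n%:R * e * `|v|.
  apply: le_trans (mulmx_bound _ _) _; rewrite ler_wpM2r // ler_wpM2l //.
  apply: norm_le_entries => [|i j]; first exact: ltW.
  by rewrite mxE; apply: le_trans (rJ y yx); exact: norm_entry_le.
have JyE : (jac c y)^T = (jac c x)^T + E^T by rewrite -linearD /= addrC subrK.
have [unitA wA] : B^T *m (jac c y)^T \in unitmx /\
    forall w : 'rV[R]_m, `|w| <= 2 * `|w *m (B^T *m (jac c y)^T)|.
  apply: near_one_unitmx => w.
  rewrite mulmxA JyE mulmxDr -mulmxA BJ mulmx1 addrC addKr.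
  apply: le_trans (vE _) _.
  apply: (@le_trans _ _ (n%:R * e * (CB * `|w|))).
    by rewrite ler_wpM2l // mulr_ge0 // ltW.
  rewrite mulrA ler_wpM2r // mulrC mulrA; apply: le_trans eB _.
  by move: th2; lra.
(* [v] is the correction for which [D *: s + v] solves the linearized
   constraints at [y]. *)
pose A := B^T *m (jac c y)^T; pose q := c y + D *: s *m (jac c y)^T.
pose w := - q *m invmx A; pose v := w *m B^T; pose d := D *: s + v.
have wAq : w *m A = - q by rewrite mulmxKV.
have dJ : c y + d *m (jac c y)^T = 0.
  by rewrite mulmxDl addrA -/q -mulmxA wAq subrr.
have q_le : `|q| <= viol c y + n%:R * e * 2^-1 * D.
  apply: le_trans (ler_normD _ _) _; rewrite lerD ?norm_le_norm1 //.
  rewrite -scalemxAl JyE mulmxDr sJ add0r normrZ ger0_norm // mulrC.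
  rewrite ler_wpM2r //; apply: le_trans (vE _) _.
  by rewrite ler_wpM2l // mulr_ge0 // ltW.
have v_le : `|v| <= th * D.
  apply: le_trans (wB _) _.
  have w_le : `|w| <= 2 * viol c y + n%:R * e * D.
    by have := wA w; rewrite wAq normrN; move: q_le; lra.
  apply: (@le_trans _ _ (CB * (2 * viol c y + n%:R * e * D))).
    by rewrite ler_wpM2l // ltW.
  have := ler_wpM2r D0 eB; move: hD'; lra.
have Ds_le : `|D *: s| <= D * 2^-1 by rewrite normrZ ger0_norm // ler_wpM2l.
have d_le : `|d| <= D.
  apply: le_trans (ler_normD _ _) _; have := ler_wpM2r D0 th2.
  by move: v_le Ds_le; lra.
exists d; first split => //.
  move=> i; rewrite mxE; have [xi|xi] := ltP 0 (x 0 i).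
    have yi : kap <= y 0 i.
      have := norm_entry_le (y - x) 0 i; rewrite !mxE ler_norml => /andP[+ _].
      by have := kx i xi; move: yx rk; lra.
    have := norm_entry_le d 0 i; rewrite ler_norml => /andP[+ _].
    by move: d_le Dk yi; lra.
  have {}xi : x 0 i = 0 by apply/eqP; rewrite eq_le xi x0.
  have si := ler_wpM2l D0 (ths i xi).
  have := norm_entry_le v 0 i; rewrite ler_norml => /andP[+ _].
  by rewrite !mxE; have := y0 i; move: v_le si; lra.
have := QP_obj_linear d WM; rewrite ler_norml => /andP[_].
rewrite lerBlDr => /le_trans; apply.
have g1 : dotp (grad f x) d <= - a * D + G * th * D.
  rewrite dotpDr dotpZr /a opprK mulrC lerD2l.
  apply: le_trans (ler_norm _) _; apply: le_trans (dotp_bound _ _) _.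
  by rewrite -/G -mulrA ler_wpM2l // mulr_ge0.
have g2 : dotp (grad f y) d - dotp (grad f x) d <= a / 4 * D.
  rewrite -dotpBl; apply: le_trans (ler_norm _) _.
  apply: le_trans (dotp_bound _ _) _; apply: le_trans (ler_wpM2r D0 ea).
  by rewrite -!mulrA ler_wpM2l // ler_pM // rg.
have q1 : CW * `|d| ^+ 2 <= a / 4 * D.
  apply: le_trans (ler_wpM2r D0 kC).
  rewrite -[leRHS]mulrA ler_wpM2l ?mulr_ge0 ?exprn_ge0 // expr2 ler_pM //.
  exact: le_trans d_le Dk.
by have := ler_wpM2r D0 thG; move: g1 g2 q1; rewrite /CW; lra.
Unshelve. all: by end_near. Qed.

End Local.

(** * The inner loop near a non-KKT point *)

Section Step.
Context {R : realType} {n m : nat}.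
Implicit Types (f g : 'rV[R]_n -> R) (c : 'rV[R]_n -> 'rV[R]_m) (x y d : 'rV[R]_n).

Lemma QP_obj0 f c x (lam : 'rV[R]_m) : QP_obj f c x lam 0 = 0.
Proof.
rewrite /QP_obj mul0mx /dotp !big1 ?mulr0 ?addr0 // => i _.
  by rewrite [X in _ * X]mxE mulr0.
by rewrite mxE mul0r.
Qed.

Section StepInversion.
Variables (f : 'rV[R]_n -> R) (c : 'rV[R]_n -> 'rV[R]_m) (P : funnel_constants R).

Lemma step_Outer x lam tau st : step f c P (Outer x lam tau) st ->
  (KKT f c x /\ st = Stopped x) \/
  exists D, [/\ ~ KKT f c x, fc_Delta0 P <= D & st = Inner x lam tau D].
Proof. by move=> h; inversion h; subst; [left|right; exists Delta]. Qed.

Lemma step_Inner x lam tau D st : step f c P (Inner x lam tau D) st ->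
  [\/ ~ (exists d, QP_feasible c x D d) /\ st = Resto x tau x,
      QP_solution f c x lam D 0 /\ st = Stopped x,
      exists d lam', [/\ QP_solution f c x lam D d, f_type f c P x lam tau d
                      & st = Outer (x + d) lam' tau]
    | (exists d lam', [/\ QP_solution f c x lam D d, h_type f c P x lam tau d
                      & st = Outer (x + d) lam' (new_width c P tau (x + d))]) \/
      exists d, [/\ QP_solution f c x lam D d, d <> 0, ~ f_type f c P x lam tau d
                  & st = Inner x lam tau (2^-1 * Num.min D `|d|)]].
Proof.
move=> h; inversion h; subst.
- by constructor 1.
- by constructor 2.
- by constructor 3; exists d, lam'.
- by constructor 4; left; exists d, lam'.
- by constructor 4; right; exists d.
Qed.

Lemma step_Resto xr tau z st : step f c P (Resto xr tau z) st ->
  (~ resto_success c P xr tau z /\ exists z', st = Resto xr tau z') \/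
  (resto_success c P xr tau z /\ exists lam', st = Outer z lam' (new_width c P tau z)).
Proof.
by move=> h; inversion h; subst; [left; split=> //; exists z'|right; split=> //; exists lam'].
Qed.

End StepInversion.

(** [Dmin] is the fixed fraction [cc] of the largest radius [T] at which an
    f-type step is certain. It is at least [mu * viol c y], so the subproblem has
    linear predicted reduction at all radii from [Dmin] up; and a step rejected
    at a radius above [T] has length at least [2 * cc * T], so the radius stays
    above [Dmin]. Both [Dmin] and the decrease [b] depend on [y] only through
    the funnel width [tau]. *)
Lemma inner_step_near (O : set 'rV[R]_n) f c (P : funnel_constants R) x
    (MW mu kap eta Ds : R) :
  valid_constants P -> open O -> O x -> C2_on O f ->
  (forall j, C2_on O (constr c j)) -> c x = 0 ->
  0 < mu -> 0 < kap -> 0 < eta -> 0 < Ds ->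
  exists2 r, 0 < r & forall tau, 0 < tau ->
    exists Dmin b, [/\ 0 < Dmin, Dmin <= Ds, 0 < b &
      forall y lam D st, `|y - x| <= r -> viol c y <= tau ->
        spectral_norm (model_hess f c y lam) <= MW ->
        qp_descent mu kap eta f c y lam -> Dmin <= D ->
        step f c P (Inner y lam tau D) st ->
        (exists2 D', Dmin <= D' & st = Inner y lam tau D') \/
        (exists x' lam', st = Outer x' lam' tau /\ b <= f y - f x')].
Proof.
move=> [[_ _ /andP[s0 s1] /andP[d0 d1]] _] oO Ox C2f C2c cx mu0 kap0 eta0 Ds0.
(* [C] bounds the predicted reduction per unit length of a step of norm at most
   one; so a solution with predicted reduction [eta * D] has length at least
   [c1 * D] if [D <= 1]. *)
pose CW := n%:R ^+ 2 * `|MW|; have CW0 : 0 <= CW by rewrite mulr_ge0 ?exprn_ge0.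
pose G := n%:R * (`|grad f x| + 1); have G0 : 0 <= G by rewrite mulr_ge0 ?addr_ge0.
pose C := G + CW + eta; have C0 : 0 < C by rewrite ltr_wpDl ?addr_ge0.
pose c1 := eta / C; have c10 : 0 < c1 by rewrite divr_gt0.
have c11 : c1 <= 1 by rewrite ler_pdivrMr // mul1r lerDr addr_ge0.
pose cc := c1 / 2; have cc0 : 0 < cc by rewrite divr_gt0.
(* [a * T] bounds the violation at [y]; this choice puts it below the
   thresholds of [qp_descent] and of the switching condition. *)
pose a := Num.min (cc / mu) (eta * cc).
have a0 : 0 < a by rewrite lt_min divr_gt0 // mulr_gt0.
have amu : mu * a <= cc by rewrite mulrC -ler_pdivlMr // ge_min lexx.
have aeta : a <= eta * cc by rewrite ge_min lexx orbT.
pose ef := (1 - fc_sigma P) * eta / 2.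
have ef0 : 0 < ef by rewrite !mulr_gt0 ?subr_gt0 ?invr_gt0.
near (0 : R)^'+ => q.
have q0 : 0 < q by near: q; exact: nbhs_right_gt.
have q1 : q <= 1 by near: q; exact: nbhs_right_le.
have qk : q <= kap by near: q; exact: nbhs_right_le.
have qD : q <= Ds by near: q; exact: nbhs_right_le.
have qC : CW * q <= ef by near: q; exact: near_right_mul.
have qg : forall y, `|y - x| <= q -> `|grad f y - grad f x| <= 1.
  by near: q; exact: (near_grad Ox).
have qf : forall y d, `|y - x| <= q -> `|d| <= q ->
    `|f (y + d) - f y - dotp (grad f y) d| <= ef * `|d|.
  by near: q; exact: (near_strict oO).
have qc : forall y d, `|y - x| <= q -> `|d| <= q ->
    norm1 (c (y + d) - c y - d *m (jac c y)^T) <= a * `|d|.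
  by near: q; exact: (near_strict_constraints oO).
near (0 : R)^'+ => r.
have r0 : 0 < r by near: r; exact: nbhs_right_gt.
have rq : r <= q by near: r; exact: nbhs_right_le.
have rh : forall y, `|y - x| <= r -> `|viol c y - viol c x| <= Num.min 1 (a * q).
  near: r; apply: (near_viol Ox C2c); by rewrite lt_min ltr01 mulr_gt0.
exists r => // tau tau0.
pose T := Num.min q (tau / a).
have T0 : 0 < T by rewrite lt_min q0 divr_gt0.
have Tq : T <= q by rewrite ge_min lexx.
have aT : a * T <= tau by rewrite mulrC -ler_pdivlMr // ge_min lexx orbT.
have ccT : cc * T <= T by rewrite ler_piMl ?(ltW T0) // /cc; move: c11; lra.
exists (cc * T), (fc_sigma P * (eta * (cc * T))).
split; [exact: mulr_gt0| |exact: mulr_gt0 s0 (mulr_gt0 eta0 (mulr_gt0 cc0 T0))|].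
  by apply: le_trans ccT (le_trans Tq qD).
move=> y lam D st yx hy WM desc DT.
have viol0 : viol c x = 0.
  by rewrite /viol cx /norm1 big1 // => i _; rewrite mxE normr0.
have h0 : 0 <= viol c y by exact: norm1_ge0.
have [h1 haT] : viol c y <= 1 /\ viol c y <= a * T.
  have := rh y yx; rewrite viol0 subr0 ger0_norm // le_min => /andP[-> haq].
  split=> //; rewrite minr_pMr ?(ltW a0) // le_min haq mulrC divfK //.
  by rewrite gt_eqF.
(* The reduction promised at the radius [Db] is also available at [D]. *)
pose Db := Num.min D T.
have DbT : cc * T <= Db by rewrite le_min DT ccT.
have Db_range : mu * viol c y <= Db <= kap.
  rewrite (le_trans _ DbT) /=; last first.
    apply: le_trans (_ : mu * (a * T) <= _); first by rewrite ler_wpM2l // ltW.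
    by rewrite mulrA ler_wpM2r // ltW.
  by rewrite ge_min (le_trans Tq qk) orbT.
have pred_lower d : QP_solution f c y lam D d -> eta * Db <= pred_red f c y lam d.
  move=> [_ dmin]; have [|e [eJ e0 eD] eobj] := desc Db.
    exact: Db_range.
  rewrite lerNr -mulNr; apply: le_trans (dmin e _) eobj; split=> //.
  by apply: le_trans eD _; rewrite ge_min lexx.
have pred_min d : QP_solution f c y lam D d ->
    eta * (cc * T) <= pred_red f c y lam d.
  by move=> /pred_lower; apply: le_trans; rewrite ler_wpM2l // ltW.
have switch d : QP_solution f c y lam D d -> switching f c P y lam d.
  move=> /pred_min; apply: le_trans.
  apply: (@le_trans _ _ (viol c y ^+ 2)).
    by rewrite ler_piMl ?exprn_ge0 // ltW.
  apply: (@le_trans _ _ (viol c y)); first by rewrite expr2 ler_piMl.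
  by apply: le_trans haT _; rewrite mulrA ler_wpM2r // ltW.
have d_lower d : QP_solution f c y lam D d -> c1 * Db <= `|d|.
  have DbT' : Db <= 1 by rewrite ge_min (le_trans Tq q1) orbT.
  move=> /pred_lower; have [dle|dgt] := lerP `|d| 1; last first.
    move=> _; apply: le_trans (ltW dgt); rewrite -[leRHS]mulr1 ler_pM //; first exact: ltW.
    exact: le_trans (ltW (mulr_gt0 cc0 T0)) DbT.
  move=> hp; rewrite /c1 mulrAC ler_pdivrMr //; apply: le_trans hp _.
  have := QP_obj_linear d WM; rewrite -/CW ler_norml => /andP[+ _].
  have gy : `|dotp (grad f y) d| <= G * `|d|.
    apply: le_trans (dotp_bound _ _) _; rewrite ler_wpM2r // ler_wpM2l //.
    have := qg y (le_trans yx rq); have := ler_normD (grad f y - grad f x) (grad f x).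
    by rewrite subrK; lra.
  have d2 : CW * `|d| ^+ 2 <= CW * `|d|.
    by rewrite ler_wpM2l // expr2 ler_piMl.
  move: gy; rewrite ler_norml => /andP[+ _]; rewrite /pred_red /C.
  have := mulr_ge0 (ltW eta0) (normr_ge0 d); move: d2; lra.
have accept d : D <= T -> QP_solution f c y lam D d -> f_type f c P y lam tau d.
  move=> DleT sd; have [[dJ dn dD] _] := sd.
  have dq : `|d| <= q by apply: le_trans dD (le_trans DleT Tq).
  split; [|exact: switch|].
    have := qc y d (le_trans yx rq) dq.
    rewrite -addrA -opprD dJ subr0 => /le_trans; apply; apply: le_trans aT.
    by rewrite ler_wpM2l ?(ltW a0) // (le_trans dD).
  have := pred_lower d sd; rewrite /Db (min_l DleT) => hp.
  have hp' : eta * `|d| <= pred_red f c y lam d.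
    by apply: le_trans hp; rewrite ler_wpM2l // ltW.
  have := qf y d (le_trans yx rq) dq; rewrite ler_norml => /andP[_].
  have := QP_obj_linear d WM; rewrite -/CW ler_norml => /andP[+ _].
  have d2 : CW * `|d| ^+ 2 <= ef * `|d|.
    rewrite expr2 mulrA ler_wpM2r //; apply: le_trans qC.
    by rewrite ler_wpM2l.
  have s1' : 0 <= 1 - fc_sigma P by rewrite subr_ge0 ltW.
  have := ler_wpM2l s1' hp'; move: d2; rewrite /ef /pred_red; lra.
move=> /step_Inner; case=> [[nf _]|[/pred_min + _]|[d [lam' [sd [_ _ fd] ->]]]|
  [[d [lam' [sd [_ nsw _] _]]]|[d [sd _ nf ->]]]].
- case: nf; have [|e [eJ e0 eD] _] := desc Db; first exact: Db_range.
  by exists e; split=> //; apply: le_trans eD _; rewrite ge_min lexx.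
- rewrite /pred_red QP_obj0 oppr0 leNgt => /negP; case.
  by rewrite mulr_gt0 // mulr_gt0.
- right; exists (y + d), lam'; split=> //; apply: le_trans fd.
  by rewrite ler_wpM2l ?pred_min // ltW.
- by case: nsw; exact: switch.
- left; eexists; last reflexivity.
  have [/accept/(_ sd)//|TD] := lerP D T.
  have := d_lower d sd; rewrite /Db (min_r (ltW TD)) => dT.
  have cD : c1 * T <= D by apply: le_trans (ltW TD); rewrite ler_piMl // ltW.
  by rewrite /cc mulrAC mulrC ler_wpM2l // le_min cD dT.
Unshelve. all: by end_near. Qed.

End Step.

(** * Structure of runs *)

Lemma geometric_small (R : realType) (q A e : R) : 0 <= q < 1 -> 0 < e ->
  exists k, q ^+ k * A < e.
Proof.
move=> /andP[q0 q1] e0.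
have qk : q ^+ k @[k --> \oo] --> 0 by apply: cvg_expr; rewrite ger0_norm.
have A0 : 0 < 1 + `|A| by rewrite ltr_pwDl.
have e'0 : 0 < e / (1 + `|A|) by rewrite divr_gt0.
have /cvgrPdist_lt/(_ _ e'0)[k _ /(_ k (leqnn k))] := qk.
rewrite sub0r normrN ger0_norm ?exprn_ge0 // ltr_pdivlMr // => h.
exists k; apply: le_lt_trans h; rewrite ler_wpM2l ?exprn_ge0 //.
by apply: le_trans (ler_norm _) _; rewrite lerDr.
Qed.

Section Run.
Context {R : realType} {n m : nat}.
Variables (f : 'rV[R]_n -> R) (c : 'rV[R]_n -> 'rV[R]_m).
Variables (P : funnel_constants R) (s : nat -> @state R n m).
Variables (X O : set 'rV[R]_n) (MW : R).
Hypothesis vP : valid_constants P.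
Hypothesis hrun : run f c P s.
Hypothesis hresto : resto_convergent c s.
Hypothesis (cX : compact X) (sX : forall i, X (current_point (s i))).
Hypothesis (oO : open O) (XO : X `<=` O).
Hypothesis (C2f : C2_on O f) (C2c : forall j, C2_on O (constr c j)).
Hypothesis hW : bounded_model_hessians f c s MW.

Let sstep i : step f c P (s i) (s i.+1).
Proof. by have [_] := hrun; exact. Qed.

Definition outer_inv (x : 'rV[R]_n) (lam : 'rV[R]_m) (tau : R) :=
  [/\ nonneg x, viol c x <= tau, 0 < tau
    & spectral_norm (model_hess f c x lam) <= MW].

Definition run_inv (st : @state R n m) : Prop :=
  match st with
  | Outer x lam tau => outer_inv x lam tau
  | Inner x lam tau D => [/\ outer_inv x lam tau, 0 < D & ~ KKT f c x]
  | Resto _ tau _ => 0 < tau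
  | Stopped x => KKT f c x
  end.

(** At a feasible non-KKT point the subproblem attains negative values at every
    positive radius, whereas [d = 0] has value zero. *)
Lemma QP_zero_KKT x lam tau D : outer_inv x lam tau -> 0 < D ->
  QP_solution f c x lam D 0 -> KKT f c x.
Proof.
move=> [_ _ _ WM] D0 [[cx x0 _] opt]; apply: contrapT => nK.
move: cx x0; rewrite mul0mx !addr0 => cx x0.
have [kap [eta [k0 e0 desc]]] := qp_descent_feasible cx x0 nK WM.
have mk : 0 < Num.min D kap by rewrite lt_min D0.
have [|d [dJ dn dD] dobj] := desc (Num.min D kap).
  rewrite mul1r /viol cx /norm1 big1 => [|i _]; last by rewrite mxE normr0.
  by rewrite ltW //= ge_min lexx orbT.
have fd : QP_feasible c x D d.
  by split=> //; apply: le_trans dD _; rewrite ge_min lexx.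
have := le_trans (opt d fd) dobj; rewrite QP_obj0 mulNr oppr_ge0 leNgt => /negP.
by apply; rewrite mulr_gt0.
Qed.

Lemma new_width_gt0 tau (x : 'rV[R]_n) : 0 < tau -> 0 < new_width c P tau x.
Proof.
have [[_ /andP[k0 k1] _ _] _] := vP => t0; rewrite ltr_wpDl ?mulr_gt0 //.
by rewrite mulr_ge0 ?norm1_ge0 // subr_ge0 ltW.
Qed.

Lemma viol_new_width tau (x : 'rV[R]_n) : viol c x <= tau ->
  viol c x <= new_width c P tau x.
Proof.
have [[_ /andP[k0 k1] _ _] _] := vP; rewrite /new_width => h.
by have := ler_wpM2l (ltW k0) h; lra.
Qed.

(** Bounds from above the factor by which h-type and restoration steps shrink
    the funnel. *)
Let theta := (1 - fc_kappa P) * fc_beta P + fc_kappa P.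

Lemma theta_range : 0 <= theta < 1.
Proof.
have [[/andP[b0 b1] /andP[k0 k1] _ _] _] := vP; rewrite /theta.
have k' : 0 < 1 - fc_kappa P by rewrite subr_gt0.
have := mulr_ge0 (ltW k') (ltW b0).
have : (1 - fc_kappa P) * fc_beta P < (1 - fc_kappa P) * 1 by rewrite ltr_pM2l.
by move=> h1 h2; apply/andP; split; lra.
Qed.

Lemma new_width_le tau (x : 'rV[R]_n) : viol c x <= fc_beta P * tau ->
  new_width c P tau x <= theta * tau.
Proof.
have [[_ /andP[k0 k1] _ _] _] := vP => h.
have k' : 0 <= 1 - fc_kappa P by rewrite subr_ge0 ltW.
by rewrite /new_width /theta; have := ler_wpM2l k' h; lra.
Qed.

Lemma resto_viol xr tau z : resto_success c P xr tau z ->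
  nonneg z /\ viol c z <= fc_beta P * tau.
Proof.
have [[/andP[b0 b1] _ _ _] _] := vP => -[z0 h _]; split=> //.
by apply: le_trans h _; rewrite ler_wpM2l ?(ltW b0) // ge_min lexx.
Qed.

Lemma run_invP i : run_inv (s i).
Proof.
have [[/andP[b0 b1] _ _ _] [t0 kb1 Dz]] := vP.
elim: i => [|i IH].
  have [[x0 [lam0 [x00 s0]]] _] := hrun; rewrite s0; split=> //.
  - rewrite le_max; apply/orP; right; rewrite ler_peMl ?norm1_ge0 //; exact: ltW.
  - by rewrite lt_max t0.
  - exact: (hW s0).
have hs := hW (i := i.+1); move: IH (sstep i) hs.
case: (s i) => [x lam tau|x lam tau D|xr tau z|x] /=.
- move=> inv /step_Outer[[K ->]//|[D [nK D0 ->]]] _; split=> //.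
  exact: lt_le_trans D0.
- move=> [inv D0 nK]; have [x0 hx tau0 WM] := inv.
  move=> /step_Inner[[_ ->]//|[/(QP_zero_KKT inv D0) K -> _]//|
    [d [lam' [[[_ dn _] _] [hd _ _] ->]]] hs|
    [[d [lam' [[[_ dn _] _] [hd _ _] ->]]]|[d [_ d0 _ ->]]] hs].
  + by split; [exact: dn|exact: hd|exact: tau0|exact: (hs _ _ _ erefl)].
  + split; [exact: dn|exact: viol_new_width|exact: new_width_gt0|].
    exact: (hs _ _ _ erefl).
  + split=> //; rewrite mulr_gt0 ?invr_gt0 // lt_min D0 normr_gt0.
    exact/eqP.
- move=> tau0 /step_Resto[[_ [z' ->]]//|[/resto_viol[z0 hz] [lam' ->]] hs].
  split; [exact: z0| |exact: new_width_gt0|exact: (hs _ _ _ erefl)].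
  by apply: viol_new_width; apply: le_trans hz _; rewrite ler_piMl ?ltW.
- by move=> K h; inversion h.
Qed.

Lemma stopped_outcome i x : s i = Stopped x -> outcome_KKT f c s.
Proof.
elim: i x => [|i IH] x; first by have [[x0 [lam0 [_ ->]]] _] := hrun.
move=> sx; have := run_invP i.+1; rewrite sx /= => K.
have := sstep i; rewrite sx; case E : (s i) => [y lam tau|y lam tau D|xr tau z|y].
- move=> /step_Outer[[_ [yE]]|[D []//]].
  by exists i, x; split=> //; left; exists lam, tau; rewrite E yE.
- move=> /step_Inner[[]//|[sol [yE]]|[d [lam' []]]//|
    [[d [lam' []]]//|[d []]//]].
  exists i, x; split=> //; right; exists lam, tau, D.
  by rewrite yE; split.
- by move=> /step_Resto[[_ [z' ]]//|[_ [lam' ]]//].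
- by move=> _; exact: IH E.
Qed.

Definition width (st : @state R n m) : R :=
  match st with
  | Outer _ _ tau => tau
  | Inner _ _ tau _ => tau
  | Resto _ tau _ => tau
  | Stopped _ => 0
  end.

Hypothesis nostop : forall i x, s i <> Stopped x.
Arguments nostop : clear implicits.

Lemma width_gt0 i : 0 < width (s i).
Proof.
have := run_invP i; have := nostop i.
case: (s i) => [x lam tau|x lam tau D|xr tau z|x] /=; last by move=> /(_ x).
- by move=> _ [].
- by move=> _ [[]].
- by [].
Qed.

Lemma width_step i :
  width (s i.+1) = width (s i) \/ width (s i.+1) <= theta * width (s i).
Proof.
have := sstep i; have := nostop i.+1; have := nostop i.
case: (s i) => [x lam tau|x lam tau D|xr tau z|x] h1 h2 /=; last by case: (h1 x).
- by move=> /step_Outer[[K E]|[D [nK D0 ->]]]; [case: (h2 x)|left].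
- move=> /step_Inner[[_ ->]|[_ E]|[d [lam' [_ _ ->]]]|
    [[d [lam' [_ [_ _ hd] ->]]]|[d [_ _ _ ->]]]].
  + by left.
  + by case: (h2 x).
  + by left.
  + by right; exact: new_width_le.
  + by left.
- move=> /step_Resto[[_ [z' ->]]|[/resto_viol[z0 hz] [lam' ->]]]; first by left.
  by right; exact: new_width_le.
Qed.

(** The steps with this property are the h-type steps and the returns from
    restoration. *)
Definition shrinks i := width (s i.+1) < width (s i).

Lemma not_shrinks i : ~ shrinks i -> width (s i.+1) = width (s i).
Proof.
have [//|h] := width_step i; case; apply: le_lt_trans h _.
have /andP[_ t1] := theta_range.
by rewrite -[ltRHS]mul1r ltr_pM2r // width_gt0.
Qed.

Lemma width_nonincreasing i k : width (s (i + k)%N) <= width (s i).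
Proof.
elim: k => [|k IH]; first by rewrite addn0.
apply: le_trans IH; rewrite addnS; have [->//|h] := width_step (i + k).
apply: le_trans h _; rewrite ler_piMl ?(ltW (width_gt0 _)) //.
by have /andP[_ /ltW] := theta_range.
Qed.

Lemma width_to0 : (forall N, exists2 i, (N <= i)%N & shrinks i) ->
  forall e, 0 < e -> exists N, forall i, (N <= i)%N -> width (s i) <= e.
Proof.
move=> inf e e0.
have [k hk] := geometric_small (width (s 0%N)) theta_range e0.
have [t0 t1] := andP theta_range.
suff [N hN] : exists N, width (s N) <= theta ^+ k * width (s 0%N).
  exists N => i Ni; apply: le_trans (ltW hk); apply: le_trans hN.
  by rewrite -(subnKC Ni) width_nonincreasing.
elim: k {hk} => [|k [N IH]]; first by exists 0%N; rewrite mul1r.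
have [i Ni si] := inf N; exists i.+1.
have [E|h] := width_step i; first by move: si; rewrite /shrinks E ltxx.
apply: le_trans h _; rewrite exprS -mulrA ler_wpM2l // (le_trans _ IH) //.
by rewrite -(subnKC Ni) width_nonincreasing.
Qed.

Lemma resto_forever i0 xr tau z : s i0 = Resto xr tau z ->
  (forall i, (i0 <= i)%N -> ~ is_outer (s i)) -> outcome_resto_failure c P s.
Proof.
move=> s0 no; have stay k : exists2 z, s (i0 + k)%N = Resto xr tau z &
    ~ resto_success c P xr tau z /\ exists z', s (i0 + k).+1 = Resto xr tau z'.
  have next y i : (i0 <= i)%N -> s i = Resto xr tau y ->
      ~ resto_success c P xr tau y /\ exists z', s i.+1 = Resto xr tau z'.
    move=> ii sy; have := sstep i; rewrite sy => /step_Resto[//|[_ [lam' E]]].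
    by case: (no i.+1); [exact: leqW|rewrite E].
  elim: k => [|k [y sy [_ [y' sy']]]].
    by exists z; rewrite addn0 //; exact: next.
  by exists y'; rewrite addnS //; apply: next => //; rewrite leqW // leq_addr.
have all i : (i0 <= i)%N -> exists2 z, s i = Resto xr tau z &
    ~ resto_success c P xr tau z.
  by move=> /subnKC <-; have [y sy [ny _]] := stay (i - i0)%N; exists y.
exists i0, xr, tau; split=> //.
have [|y [ylim ny _]] := hresto (i0 := i0) (xr := xr) (tau := tau); last by exists y.
by move=> i /all[y sy _]; exists y.
Qed.

(** An inner loop that never ends drives the radius to zero while the
    subproblems stay feasible, so its base point is feasible; there the
    descent direction makes all small radii acceptable. *)
Lemma inner_terminates i0 x lam tau D : s i0 = Inner x lam tau D ->
  ~ forall k, exists D', s (i0 + k)%N = Inner x lam tau D'.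
Proof.
move=> s0 all.
have half k : exists D', [/\ s (i0 + k)%N = Inner x lam tau D',
    D' <= 2^-1 ^+ k * D & exists d, QP_feasible c x D' d].
  have next i E E' : s i = Inner x lam tau E -> s i.+1 = Inner x lam tau E' ->
      E' <= 2^-1 * E /\ exists d, QP_feasible c x E d.
    move=> sE sE'; have := sstep i; rewrite sE sE'.
    move=> /step_Inner[[]//|[]//|[d [lam' []]]//|[[d [lam' []]]//|[d [[sd _] _ _ [->]]]]].
    by split; [rewrite ler_wpM2l ?invr_ge0 // ge_min lexx|exists d].
  elim: k => [|k [E [sE Ek _]]].
    exists D; rewrite addn0 mul1r; split=> //.
    by have [E' sE'] := all 1%N; rewrite addn1 in sE'; have [] := next _ _ _ s0 sE'.
  have [E' sE'] := all k.+1; have [E'' sE''] := all k.+2.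
  rewrite addnS in sE'; rewrite 2!addnS in sE''.
  have [E'E _] := next _ _ _ sE sE'; have [_ fs] := next _ _ _ sE' sE''.
  exists E'; rewrite addnS; split=> //; apply: le_trans E'E _.
  by rewrite exprS -mulrA ler_wpM2l ?invr_ge0.
have h2 : 0 <= (2^-1 : R) < 1 by rewrite invr_ge0 ler0n /= invf_lt1 // ltr1n.
have := run_invP i0; rewrite s0 => -[[x0 hx tau0 WM] D0 nK].
have cx : c x = 0.
  apply: contrapT => /eqP; rewrite -normr_gt0 => cx0.
  pose K := n%:R * `|(jac c x)^T|; have K0 : 0 <= K by rewrite mulr_ge0.
  have [k hk] := geometric_small (K * D) h2 cx0.
  have [D' [_ D'k [d [dJ _ dD']]]] := half k.
  suff : `|c x| < `|c x| by rewrite ltxx.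
  apply: le_lt_trans hk; move/eqP: dJ; rewrite addr_eq0 => /eqP ->.
  rewrite normrN; apply: le_trans (mulmx_bound _ _) _; rewrite -/K mulrCA.
  by rewrite ler_wpM2l // (le_trans dD').
have Ox : O x by apply: XO; have := sX i0; rewrite s0.
have [kap [eta [k0 e0 desc]]] := qp_descent_feasible cx x0 nK WM.
have [r r0 /(_ tau tau0)[Dmin [b [Dm0 DmD b0 st]]]] :=
  inner_step_near MW vP oO Ox C2f C2c cx ltr01 k0 e0 D0.
have ge k : exists2 D', Dmin <= D' & s (i0 + k)%N = Inner x lam tau D'.
  elim: k => [|k [D' DD' sD']]; first by exists D; rewrite ?addn0.
  have := sstep (i0 + k); rewrite sD' addnS => /st.
  rewrite subrr normr0 => /(_ (ltW r0) hx WM desc DD')[//|[x' [lam' [E _]]]].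
  by have [D''] := all k.+1; rewrite addnS E.
have [k hk] := geometric_small D h2 Dm0.
have [D' DD' sD'] := ge k; have [D'' [sD'' D''k _]] := half k.
move: sD''; rewrite sD' => -[DE]; move: DD'; rewrite DE => /le_trans-/(_ _ D''k).
by rewrite leNgt hk.
Qed.

Lemma finitely_many_outer N : (forall i, (N <= i)%N -> ~ is_outer (s i)) ->
  outcome_resto_failure c P s.
Proof.
move=> no; apply: contrapT => nr.
have noresto i : (N <= i)%N -> forall xr tau z, s i <> Resto xr tau z.
  move=> Ni xr tau z E; apply: nr; apply: resto_forever E _ => l il.
  by apply: no; exact: leq_trans il.
case E : (s N) => [x lam tau|x lam tau D|xr tau z|x].
- by apply: (no N (leqnn N)); rewrite E.
- apply: (inner_terminates E); elim=> [|k [D' sD']].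
    by exists D; rewrite addn0.
  have Nk : (N <= (N + k).+1)%N by rewrite leqW // leq_addr.
  have := sstep (N + k); rewrite sD' addnS => st.
  have := no _ Nk; have := noresto _ Nk; have := nostop (N + k).+1.
  move: st => /step_Inner[[_ ->]|[_ ->]|[d [lam' [_ _ ->]]]|
    [[d [lam' [_ _ ->]]]|[d [_ _ _ ->]]]] h1 h2 h3.
  + by case: (h2 x tau x).
  + by case: (h1 x).
  + by case: h3.
  + by case: h3.
  + by eexists.
- exact: noresto E.
- exact: nostop E.
Qed.

(** The alternative is an invariant of the inner loop; since a later outer
    iteration exists, the loop leaves it through the second case. *)
Lemma outer_phase j x lam tau (Dmin b : R) : s j = Outer x lam tau ->
  Dmin <= fc_Delta0 P ->
  (forall l D, (j < l)%N -> s l = Inner x lam tau D -> Dmin <= D ->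
    (exists2 D', Dmin <= D' & s l.+1 = Inner x lam tau D') \/
    (exists x' lam', s l.+1 = Outer x' lam' tau /\ b <= f x - f x')) ->
  (exists2 j2, (j < j2)%N & is_outer (s j2)) ->
  exists j' x' lam', [/\ (j < j')%N, s j' = Outer x' lam' tau, b <= f x - f x'
    & forall l, (j < l < j')%N -> exists D, s l = Inner x lam tau D].
Proof.
move=> sj DD0 alt [j2 jj2 oj2]; apply: contrapT => nconcl.
suff all k : forall l, (j < l <= (j + k).+1)%N ->
    exists2 D, Dmin <= D & s l = Inner x lam tau D.
  have [|D _ sD] := all (j2 - j.+1)%N j2; last by move: oj2; rewrite sD.
  lia.
elim: k => [|k IH] l.
  rewrite addn0 => lj; have -> : l = j.+1 by apply/eqP; rewrite eqn_leq andbC.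
  have := sstep j; have := nostop j.+1; rewrite sj.
  move=> ns /step_Outer[[_ /ns]//|[D [_ D0 ->]]].
  by exists D => //; exact: le_trans D0.
move=> /andP[jl]; rewrite addnS leq_eqVlt => /orP[/eqP ->|lk]; last first.
  by apply: IH; lia.
have [|D DD sD] := IH (j + k).+1; first lia.
have [|//|[x' [lam' [sO bf]]]] := alt _ _ _ sD DD; first lia.
case: nconcl; exists (j + k).+2, x', lam'; split=> //.
  lia.
move=> i /andP[ji ik]; have [|D' _ sD'] := IH i; last by exists D'.
by rewrite ji -ltnS.
Qed.

(** * Runs with infinitely many outer iterations *)

Hypothesis outer_inf : forall N, exists2 j, (N <= j)%N & is_outer (s j).

(** The bound [Dmin] of [inner_step_near] can be taken below all initial radii,
    and the decrease it provides does not depend on the iterate; this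
    uniformity in [j] is what the two final cases use. *)
Lemma outer_near x : X x -> feasible c x -> ~ KKT f c x -> MFCQ c x ->
  exists2 r, 0 < r & forall tau, 0 < tau -> exists2 b, 0 < b &
    forall j y lam, s j = Outer y lam tau -> `|y - x| <= r ->
    exists j' y' lam', [/\ (j < j')%N, s j' = Outer y' lam' tau, b <= f y - f y'
      & forall l, (j < l < j')%N -> exists D, s l = Inner y lam tau D].
Proof.
move=> /XO Ox [cx x0] nK mf; have [_ [_ _ D0]] := vP.
have [r1 [mu [kap [eta [r10 mu0 k0 e0 desc]]]]] :=
  qp_descent_MFCQ MW Ox C2f C2c cx x0 nK mf.
have [r2 r20 st] := inner_step_near MW vP oO Ox C2f C2c cx mu0 k0 e0 D0.
exists (Num.min r1 r2) => [|tau tau0]; first by rewrite lt_min r10.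
have [Dmin [b [Dm0 DmD b0 alt]]] := st tau tau0; exists b => // j y lam sj.
rewrite le_min => /andP[yr1 yr2].
have := run_invP j; rewrite sj => -[y0 hy _ WM].
apply: (outer_phase sj DmD) => [l D jl sl DD|]; last first.
  by have [j2 jj2 oj2] := outer_inf j.+1; exists j2.
have := sstep l; rewrite sl; exact: alt (desc _ _ y0 yr1 WM) DD.
Qed.

Lemma cluster_point (B : set nat) :
  (forall N, exists2 j, (N <= j)%N & B j) -> (forall j, B j -> is_outer (s j)) ->
  exists x, [/\ X x, accumulation_point s x &
    forall r N, 0 < r -> exists j, [/\ (N <= j)%N, B j &
                                      `|current_point (s j) - x| <= r]].
Proof.
move=> Binf Bo.
pose F := fmap (fun i => current_point (s i)) (within B \oo).
have PF : ProperFilter F.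
  apply: Build_ProperFilter_ex => A [N _ NA].
  have [j Nj Bj] := Binf N; exists (current_point (s j)); exact: NA Nj Bj.
have [|x [Xx clx]] := cX PF; first by exists 0%N => // i _ _; exact: sX.
exists x; split=> //.
  move=> A V [N _ NA] Vx; apply: clx => //; exists N => // i Ni Bi.
  by apply: NA => //; exact: Bo.
move=> r N r0.
have [|z [[j [Nj Bj <-]] zr]] := clx
    [set current_point (s j) | j in [set j | (N <= j)%N /\ B j]] _ _
    (nbhsx_ballx x r r0).
  by exists N => // i Ni Bi; exists i.
exists j; split=> //; rewrite distrC ltW //.
by move: zr; rewrite -ball_normE.
Qed.

(** The set [B] of outer iterations is a parameter because the iterates that
    contradict [outer_near] are only those followed by a shrinking step when
    the funnel shrinks infinitely often. *)
Lemma outcome_of_cluster (B : set nat) :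
  (forall N, exists2 j, (N <= j)%N & B j) -> (forall j, B j -> is_outer (s j)) ->
  (forall e, 0 < e -> exists N, forall j, (N <= j)%N -> B j ->
     viol c (current_point (s j)) <= e) ->
  (forall x, X x -> feasible c x -> ~ KKT f c x -> MFCQ c x ->
     ~ forall r N, 0 < r -> exists j, [/\ (N <= j)%N, B j &
                                      `|current_point (s j) - x| <= r]) ->
  outcome_accumulation f c s.
Proof.
move=> Binf Bo hB contra; have [x [Xx acc clx]] := cluster_point Binf Bo.
have Ox : O x by exact: XO.
have x0 : nonneg x.
  move=> i; rewrite leNgt; apply/negP => xi.
  have xi2 : 0 < - x 0 i / 2 by rewrite divr_gt0 // oppr_gt0.
  have [j [_ /Bo oj xj]] := clx _ 0%N xi2.
  have := norm_entry_le (current_point (s j) - x) 0 i.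
  have := run_invP j; case: (s j) oj xj => // y lam tau _ /= yx [y0 _ _ _].
  rewrite !mxE ler_norml => /andP[_]; have := y0 i; move: yx xi; lra.
have cx : c x = 0.
  apply/eqP; rewrite -normr_le0; apply: le_trans (norm_le_norm1 _) _.
  rewrite leNgt; apply/negP; rewrite -/(viol c x) => h0.
  have h3 : 0 < viol c x / 3 by rewrite divr_gt0.
  near (0 : R)^'+ => r.
  have r0 : 0 < r by near: r; exact: nbhs_right_gt.
  have rh : forall y, `|y - x| <= r -> `|viol c y - viol c x| <= viol c x / 3.
    by near: r; exact: (near_viol Ox).
  have [N hN] := hB _ h3; have [j [Nj Bj /rh]] := clx r N r0.
  rewrite ler_norml => /andP[+ _]; have := hN j Nj Bj; move: h0; lra.
exists x; split=> //; have [K|nK] := pselect (KKT f c x); first by left.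
by right=> mf; exact: (contra x) clx.
Unshelve. all: by end_near. Qed.

(** The width, hence the violation, tends to zero. The outer iterations in [B]
    end with a shrinking step, so their iterates stay away from the points of
    [outer_near], around which only f-type steps are taken. *)
Lemma outcome_shrinking :
  (forall N, exists2 i, (N <= i)%N & shrinks i) -> outcome_accumulation f c s.
Proof.
move=> sinf.
pose B : set nat := [set j | is_outer (s j) /\ exists i, [/\ (j <= i)%N,
  shrinks i & forall l, (j < l <= i)%N -> ~ is_outer (s l)]].
apply: (@outcome_of_cluster B) => [N|j [] //|e e0|x Xx fx nK mf clx].
- (* The last outer iteration before a shrinking step belongs to [B]. *)
  have [N' NN' oN'] := outer_inf N; have [i N'i si] := sinf N'.
  pose p j := `[< is_outer (s j) >] && (j <= i)%N.
  have pN' : exists j, p j by exists N'; rewrite /p N'i andbT; apply/asboolP.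
  have pi j : p j -> (j <= i)%N by case/andP.
  have [j /andP[/asboolP oj ji] jmax] := ex_maxnP pN' pi; exists j.
    by apply: leq_trans NN' (jmax _ _); rewrite /p N'i andbT; apply/asboolP.
  split=> //; exists i; split=> // l /andP[jl li] ol.
  have : (l <= j)%N by apply: jmax; rewrite /p li andbT; apply/asboolP.
  by rewrite leqNgt jl.
- have [N hN] := width_to0 sinf e0; exists N => j Nj [oj _].
  apply: le_trans (hN j Nj); have := run_invP j.
  by case: (s j) oj => // y lam tau _ [].
have [r r0 near_x] := outer_near Xx fx nK mf.
have [j [_ [oj [i [ji si no]]] jx]] := clx r 0%N r0.
have jt := width_gt0 j; move: oj jx jt.
case sj : (s j) => [y lam tau|||] //= _ yx /near_x[b b0 /(_ j y lam sj yx)].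
move=> [j' [y' [lam' [jj' sj' _ mid]]]].
have ij' : (i < j')%N.
  rewrite ltnNge; apply/negP => j'i; apply: (no j'); first by rewrite jj'.
  by rewrite sj'.
have same l : (j <= l <= j')%N -> width (s l) = tau.
  rewrite leq_eqVlt => /andP[/orP[/eqP <- _|jl]]; first by rewrite sj.
  rewrite leq_eqVlt => /orP[/eqP ->|lj']; first by rewrite sj'.
  by have [|D ->] := mid l; first by rewrite jl.
move: si; rewrite /shrinks (same i.+1) ?(same i) ?ltxx //.
  by rewrite ji ltnW.
by rewrite leqW.
Qed.

(** From [N] on all steps are f-type: [f] decreases, by
    at least a multiple of the squared violation, and is bounded below on [X].
    So the violation tends to zero and no outer iteration can keep
    decreasing [f] by a fixed amount. *)
Lemma outcome_constant N : (forall i, (N <= i)%N -> ~ shrinks i) ->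
  outcome_accumulation f c s.
Proof.
move=> const; have [[_ _ /andP[sg0 sg1] /andP[dl0 dl1]] [_ _ Dz]] := vP.
pose F i := f (current_point (s i)).
have same i : (N <= i)%N -> width (s i) = width (s N).
  move=> /subnKC <-; elim: (i - N)%N => [|k IH]; first by rewrite addn0.
  by rewrite addnS not_shrinks //; apply: const; exact: leq_addr.
have theta_lt i w : (N <= i)%N -> width (s i.+1) = w -> ~ w <= theta * width (s i).
  move=> Ni <-; rewrite (not_shrinks (const i Ni)) => /le_lt_trans H.
  suff : width (s i) < width (s i) by rewrite ltxx.
  apply: H; have /andP[_ t1] := theta_range.
  by rewrite gtr_pMl // width_gt0.
have noresto i : (N <= i)%N -> forall xr tau z, s i <> Resto xr tau z.
  move=> Ni xr tau z si.
  suff all k : exists z', s (i + k)%N = Resto xr tau z'.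
    have [j ij oj] := outer_inf i; have [z' sz'] := all (j - i)%N.
    by move: oj; rewrite -(subnKC ij) sz'.
  elim: k => [|k [z' sz']]; first by exists z; rewrite addn0.
  have Nk : (N <= i + k)%N by apply: leq_trans Ni (leq_addr _ _).
  have := sstep (i + k); rewrite sz' => /step_Resto[[_]|]; first by rewrite addnS.
  move=> [/resto_viol[_ hz] [lam' sE]]; case: (theta_lt _ _ Nk (erefl _)).
  by rewrite sE sz' /=; exact: new_width_le.
have inner i x lam tau D : (N <= i)%N -> s i = Inner x lam tau D -> 0 < D /\
    ((exists2 D', 0 < D' & s i.+1 = Inner x lam tau D') \/
    exists x' lam', s i.+1 = Outer x' lam' tau /\
      fc_sigma P * (fc_delta P * viol c x ^+ 2) <= f x - f x').
  move=> Ni si; have := run_invP i; rewrite si => -[inv D0 nK]; split=> //.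
  have Ni' : (N <= i.+1)%N by rewrite leqW.
  have := sstep i; have := run_invP i.+1; have := noresto _ Ni'.
  have := nostop i.+1; rewrite si => ns nr inv'.
  move=> /step_Inner[[_ /nr//]|[_ /ns//]|[d [lam' [_ [_ sw fd] ->]]]|
    [[d [lam' [_ [_ _ hd] sE]]]|[d [_ _ _ sE]]]].
  - right; exists (x + d), lam'; split=> //; apply: le_trans fd.
    by rewrite ler_wpM2l // ltW.
  - case: (theta_lt _ _ Ni (erefl _)); rewrite sE si /=.
    exact: new_width_le.
  - left; eexists; last exact: sE.
    by move: inv'; rewrite sE => -[].
have dec0 (x : 'rV[R]_n) : 0 <= fc_sigma P * (fc_delta P * viol c x ^+ 2).
  by rewrite mulr_ge0 ?(ltW sg0) // mulr_ge0 ?(ltW dl0) // exprn_ge0 // norm1_ge0.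
have Fstep i : (N <= i)%N -> F i.+1 <= F i.
  move=> Ni; rewrite /F; case si : (s i) => [x lam tau|x lam tau D|xr tau z|x].
  - have := sstep i; rewrite si => /step_Outer[[_ /nostop//]|[D [_ _ ->]]] //=.
  - have [_ [[D' _ ->//]|[x' [lam' [-> /=]]]]] := inner _ _ _ _ _ Ni si.
    by move=> /(le_trans (dec0 x)); rewrite subr_ge0.
  - by case: (noresto i Ni xr tau z).
  - by case: (nostop i x).
have Fmono i k : (N <= i)%N -> F (i + k)%N <= F i.
  move=> Ni; elim: k => [|k IH]; first by rewrite addn0.
  by rewrite addnS; apply: le_trans IH; apply: Fstep; exact: leq_trans (leq_addr _ _).
have cauchy e : 0 < e -> exists2 N', (N <= N')%N & forall i j, (N' <= i)%N ->
    (i <= j)%N -> F i - F j <= e.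
  move=> e0; pose E := [set F i | i in [set i | (N <= i)%N]].
  have [x0 Xx0 fmin] : exists2 x0, x0 \in X & forall t, t \in X -> f x0 <= f t.
    apply: compact_EVT_min => //; first by exists (current_point (s 0%N)).
    apply: continuous_in_subspaceT => x /set_mem /XO Ox.
    by have [/differentiable_continuous] := C2f Ox.
  have lbE : has_inf E.
    split; first by exists (F N), N => //=.
    by exists (f x0) => _ [i _ <-]; apply: fmin; apply/mem_set.
  have [_ [N' NN' <-] hN'] := inf_adherent e0 lbE; exists N' => // i j N'i ij.
  have Fi : F i <= F N' by rewrite -(subnKC N'i) Fmono.
  have Fj : inf E <= F j.
    apply: ge_inf; first by case: lbE.
    by exists j => //=; exact: leq_trans NN' (leq_trans N'i ij).
  by move: hN' Fi Fj; lra.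
apply: (@outcome_of_cluster [set j | is_outer (s j)]) => //.
  move=> e e0.
  have e'0 : 0 < fc_sigma P * (fc_delta P * e ^+ 2).
    by rewrite !mulr_gt0 ?exprn_gt0.
  have [N' NN' hN'] := cauchy _ e'0; exists N' => j N'j /=.
  have Nj : (N <= j)%N by exact: leq_trans N'j.
  case sj : (s j) => [x lam tau|||] //= _.
  have [] := @outer_phase j x lam tau 0 (fc_sigma P * (fc_delta P * viol c x ^+ 2)) sj.
  - exact: ltW.
  - move=> l D jl sl _; have Nl : (N <= l)%N by apply: leq_trans Nj (ltnW jl).
    have [_ [[D' D'0 sD']|]] := inner _ _ _ _ _ Nl sl; last by right.
    by left; exists D' => //; exact: ltW.
  - by have [j2 jj2 oj2] := outer_inf j.+1; exists j2.
  move=> j' [x' [lam' [jj' sj' fd _]]].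
  have := hN' j j' N'j (ltnW jj'); rewrite /F sj sj' /= => /(le_trans fd).
  rewrite ler_pM2l // ler_pM2l // ler_pXn2r ?nnegrE ?norm1_ge0 //.
  exact: ltW.
move=> x Xx fx nK mf clx.
have [r r0 near_x] := outer_near Xx fx nK mf.
have [b b0 phase] := near_x _ (width_gt0 N).
have b2 : 0 < b / 2 by rewrite divr_gt0.
have [N' NN' hN'] := cauchy _ b2; have [j [N'j oj jx]] := clx r N' r0.
have Nj := leq_trans NN' N'j; have := same j Nj; move: oj jx; rewrite /mkset.
case sj : (s j) => [y lam tau|||] //= _ yx tauE.
rewrite tauE in sj.
have [j' [y' [lam' [jj' sj' fd _]]]] := phase j y lam sj yx.
have := hN' j j' N'j (ltnW jj'); rewrite /F sj sj' /=.
by move: fd b0; lra.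
Qed.

End Run.

Theorem theorem2 (R : realType) (n m : nat)
  (f : 'rV[R]_n -> R) (c : 'rV[R]_n -> 'rV[R]_m)
  (P : funnel_constants R) (s : nat -> @state R n m)
  (X O : set 'rV[R]_n) (M MW : R) :
  valid_constants P ->
  run f c P s ->
  resto_convergent c s ->
  X !=set0 -> compact X -> (forall i, X (current_point (s i))) ->
  open O -> X `<=` O ->
  C2_on O f -> (forall j, C2_on O (constr c j)) ->
  0 < M -> bounded_hessians f c X M ->
  bounded_model_hessians f c s MW ->
  outcome_resto_failure c P s \/ outcome_KKT f c s \/
  outcome_accumulation f c s.
Proof.
move=> vP hrun hresto _ cX sX oO XO C2f C2c _ _ hW.
have [[i [x sx]]|/forallNP ns] := pselect (exists i x, s i = Stopped x).
  by right; left; apply: (stopped_outcome vP hrun hW sx).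
have nostop i x : s i <> Stopped x by move=> sx; apply: (ns i); exists x.
have [|/forallNP inf] := pselect (exists N, forall i, (N <= i)%N -> ~ is_outer (s i)).
  move=> [N no]; left.
  exact: (finitely_many_outer vP hrun hresto sX oO XO C2f C2c hW nostop no).
have outer_inf N : exists2 j, (N <= j)%N & is_outer (s j).
  by have /existsNP[j /not_implyP[Nj /contrapT oj]] := inf N; exists j.
right; right.
have [sh|/existsNP[N no]] :=
  pselect (forall N, exists2 i, (N <= i)%N & shrinks s i).
  exact: (outcome_shrinking vP hrun cX sX oO XO C2f C2c hW nostop outer_inf sh).
apply: (outcome_constant vP hrun cX sX oO XO C2f C2c hW nostop outer_inf (N := N)).
by move=> i Ni si; apply: no; exists i.
Qed.
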